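(* Let $k\ge 2$ be an integer. For any $\mathcal L_{\mathsf{BA}}$-formula $\varphi(\vec x)$, with $\vec x=(x_1,\dots,x_m)$, there exists a deterministic finite automaton $A$ over the alphabet $\Sigma_k^m$ such that $$\mathsf{T}_k\vdash\forall\vec x\ \Big(\varphi(\vec x)\leftrightarrow\bigvee_{q\in F}W_{A,q}\big(\vec x,g(\vec x)\big)\Big),$$ where $F$ denotes the set of accepting states of $A$.
   Context: Fix an integer $k\ge 2$. $\mathcal L_{\mathsf{BA}}=(0,S,+,V_k,\le)$ is a first-order language with equality ($S,V_k$ unary functions, $+$ binary function, $\le$ binary relation); $x<y$ means $x\le y\wedge x\neq y$. $\varphi(x_1,\dots,x_m)$ indicates that the free variables of $\varphi$ are among $x_1,\dots,x_m$. Terms: $\underline n=S(S(\dots S(0)\dots))$ ($n$ times); for a term $t$ and $n\in\mathbb N$, $nt=t+(t+(\dots(t+0)\dots))$ ($n$ copies of $t$). A formula is $\Delta_0$ (bounded) if every quantifier in it is of the form $\exists x\le t$ or $\forall x\le t$ with $x$ not occurring in the term $t$ (quantifiers bounded by $<t$ are treated as abbreviations in the usual way). Abbreviations: $P_k(d):\iff d>0\wedge V_k(d)=d$; $x\equiv_k y:\iff \exists z\le x+y\ (x=y+kz\vee y=x+kz)$; for $a\in\{0,\dots,k-1\}$, $(x)_d=a:\iff P_k(d)\wedge\exists y<d\ \exists z\le x\ \big(x=y+ad+z\wedge(z=0\vee V_k(z)>d)\big)$; $\exists^{P_k}d\,\varphi$ means $\exists d\,(P_k(d)\wedge\varphi)$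 and $\forall^{P_k}d\,\varphi$ means $\forall d\,(P_k(d)\to\varphi)$, similarly with bounds on $d$. The theory $\mathsf{T}_k$ consists of the universal closures of: (Add) the axioms of discretely ordered commutative cancellative monoids: $+$ is commutative, associative, cancellative with neutral element $0$; $\le$ is a linear order compatible with $+$; $S(x)=x+S(0)$; and $x<y\leftrightarrow S(x)\le y$; (Ord0) $x\ge 0$; (Ord1) $x\le y\leftrightarrow\exists z\le y\,(z+x=y)$; (Mod) $\bigvee_{a=0}^{k-1}(x\equiv_k\underline a)$; (V0) $V_k(0)=0$, $V_k(\underline 1)=\underline 1$; (V1) $V_k(kx)=kV_k(x)$, and $P_k(d)\to\bigwedge_{a=1}^{k-1}(V_k(ad)=d)$; (V2) $(x>0\wedge y>0\wedge V_k(x)<V_k(y))\to V_k(x+y)=V_k(x)$; (V3) $x>0\to\exists y\le x\ \bigvee_{a=1}^{k-1}\big(x=y+aV_k(x)\wedge(V_k(y)>V_k(x)\vee y=0)\big)$; (V4) $x>0\to\exists^{P_k}d\le x\ (d\le x<kd)$; (V5) $V_k(V_k(x))=V_k(x)$; (Comp) $P_k(d)\to\exists x<d\ \forall^{P_k}d'<d\ \Big(\big((x)_{d'}=1\wedge\varphi(d',\vec y)\big)\vee\big((x)_{d'}=0\wedge\neg\varphi(d',\vec y)\big)\Big)$, for every $\Delta_0$-formula $\varphi(d,\vec y)$ (free variables among $d,\vec y$). Automata: $\Sigma_k=\{0,\dots,k-1\}$. A finite automaton over $\Sigma_k^m$ is $A=(\Sigma_k^m,Q,q_0,F,\Delta)$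 with $Q$ a finite set of states, $q_0\in Q$ initial, $F\subseteq Q$ accepting, $\Delta\subseteq Q\times\Sigma_k^m\times Q$; it is deterministic (DFA) if $\Delta$ is a total function $Q\times\Sigma_k^m\to Q$. For $q_1\in Q$, $W_{A,q_1}(x_1,\dots,x_m,d)$ is the $\Delta_0$-formula $$P_k(d)\wedge\exists(w_q)_{q\in Q}<kd\ \Big(\forall^{P_k}d'\le d\bigvee_{q\in Q}\big((w_q)_{d'}=1\wedge\bigwedge_{q'\ne q}((w_{q'})_{d'}=0)\big)\wedge(w_{q_0})_{\underline 1}=1\wedge(w_{q_1})_d=1\wedge$$ $$\forall^{P_k}d'<d\bigwedge_{q\in Q}\big((w_q)_{d'}=1\to\bigvee_{(q,\vec a,q')\in\Delta}\big((w_{q'})_{kd'}=1\wedge\bigwedge_{i=1}^m(x_i)_{d'}=a_i\big)\big)\Big),$$ where $\exists(w_q)_{q\in Q}<kd$ is a block of $|Q|$ bounded existential quantifiers. The function $g=g_n$ maps $(x_1,\dots,x_n)$ to the least power of $k$ strictly greater than each $x_i$; the graph $g_n(x_1,\dots,x_n)=d$ is given by the formula $$\Big(\bigwedge_{i=1}^n(x_i=0)\wedge d=\underline 1\Big)\vee\Big(P_k(d)\wedge\bigvee_{i=1}^n\big(\bigwedge_{j=1}^n(x_i\ge x_j)\wedge x_i<d\wedge d\le kx_i\big)\Big),$$ and $W_{A,q}(\vec x,g(\vec x))$ abbreviates $\exists d\,(g(\vec x)=d\wedge W_{A,q}(\vec x,d))$ (where the quantifier on $d$ can be bounded by a term in $\vec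 x$). *)

(* Defs.v *)
(* First-order logic with equality over the signature (0, S, +, V_k, <=), deeply
   embedded. *)
From HB Require Import structures.
From mathcomp Require Import all_boot.

Set Implicit Arguments.
Unset Strict Implicit.
Unset Printing Implicit Defensive.

(* Variables are de Bruijn indices: below a quantifier, [Var 0] is the bound
   variable and [Var i.+1] is the [Var i] of the outside.  [Vk] is the symbol
   V_k; only the axioms, not the syntax, depend on k. *)
Inductive term : Type :=
| Var of nat
| Zero
| Succ of term
| Plus of term & term
| Vk of term.

Inductive formula : Type :=
| fBot
| fEq of term & term
| fLe of term & term
| fAnd of formula & formula
| fOr of formula & formula
| fImp of formula & formula
| fAll of formula
| fEx of formula.

Definition term_eq_dec : comparable term.
Proof. by rewrite /comparable /decidable; do 2 decide equality. Defined.
HB.instance Definition _ := hasDecEq.Build term (compareP term_eq_dec).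

Definition formula_eq_dec : comparable formula.
Proof.
by rewrite /comparable /decidable; decide equality; exact: term_eq_dec.
Defined.
HB.instance Definition _ := hasDecEq.Build formula (compareP formula_eq_dec).

Definition fNot (p : formula) := fImp p fBot.
Definition fTop := fNot fBot.
Definition fIff (p q : formula) := fAnd (fImp p q) (fImp q p).
Definition fLt (s t : term) := fAnd (fLe s t) (fNot (fEq s t)).

Definition num (n : nat) : term := iter n Succ Zero.
Definition tmul (n : nat) (t : term) : term := iter n (Plus t) Zero.

Declare Scope fo_scope.
Delimit Scope fo_scope with fo.
Bind Scope fo_scope with term.
Bind Scope fo_scope with formula.
Arguments Var n%_nat_scope.
Arguments num n%_nat_scope.
Arguments tmul n%_nat_scope t%_fo_scope.

Notation "0" := Zero : fo_scope.
Notation "s + t" := (Plus s t) : fo_scope.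
Notation "n * t" := (tmul n t) : fo_scope.
Notation "s = t" := (fEq s t) : fo_scope.
Notation "s <= t" := (fLe s t) : fo_scope.
Notation "s < t" := (fLt s t) : fo_scope.
Notation "p /\ q" := (fAnd p q) : fo_scope.
Notation "p \/ q" := (fOr p q) : fo_scope.
Notation "p -> q" := (fImp p q) : fo_scope.
Notation "p <-> q" := (fIff p q) : fo_scope.
Notation "~ p" := (fNot p) : fo_scope.

Fixpoint tsubst (s : nat -> term) (t : term) : term :=
  match t with
  | Var i => s i
  | Zero => Zero
  | Succ u => Succ (tsubst s u)
  | Plus u v => Plus (tsubst s u) (tsubst s v)
  | Vk u => Vk (tsubst s u)
  end.

Definition shn (n : nat) : term -> term := tsubst (fun i => Var (n + i)).
Notation sh := (shn 1).

Definition scons (t : term) (s : nat -> term) (i : nat) : term :=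
  if i is j.+1 then s j else t.

Fixpoint fsubst (s : nat -> term) (p : formula) : formula :=
  let up := scons (Var 0) (fun i => sh (s i)) in
  match p with
  | fBot => fBot
  | fEq t u => fEq (tsubst s t) (tsubst s u)
  | fLe t u => fLe (tsubst s t) (tsubst s u)
  | fAnd p q => fAnd (fsubst s p) (fsubst s q)
  | fOr p q => fOr (fsubst s p) (fsubst s q)
  | fImp p q => fImp (fsubst s p) (fsubst s q)
  | fAll p => fAll (fsubst up p)
  | fEx p => fEx (fsubst up p)
  end.

Definition fsh : formula -> formula := fsubst (fun i => Var i.+1).
Definition inst (t : term) : formula -> formula := fsubst (scons t Var).

(* The least N such that all free variables are among Var 0, ..., Var N.-1. *)
Fixpoint tbound (t : term) : nat :=
  match t with
  | Var i => i.+1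
  | Zero => 0
  | Succ u => tbound u
  | Plus u v => maxn (tbound u) (tbound v)
  | Vk u => tbound u
  end.

Fixpoint fbound (p : formula) : nat :=
  match p with
  | fBot => 0
  | fEq t u | fLe t u => maxn (tbound t) (tbound u)
  | fAnd p q | fOr p q | fImp p q => maxn (fbound p) (fbound q)
  | fAll p | fEx p => (fbound p).-1
  end.

Definition closure (p : formula) : formula := iter (fbound p) fAll p.

(* Classical natural deduction; G is the finite list of open assumptions. *)
Inductive nd : seq formula -> formula -> Prop :=
| nd_ax G p : p \in G -> nd G p
| nd_impI G p q : nd (p :: G) q -> nd G (fImp p q)
| nd_impE G p q : nd G (fImp p q) -> nd G p -> nd G q
| nd_andI G p q : nd G p -> nd G q -> nd G (fAnd p q)
| nd_andE1 G p q : nd G (fAnd p q) -> nd G p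
| nd_andE2 G p q : nd G (fAnd p q) -> nd G q
| nd_orI1 G p q : nd G p -> nd G (fOr p q)
| nd_orI2 G p q : nd G q -> nd G (fOr p q)
| nd_orE G p q r : nd G (fOr p q) -> nd (p :: G) r -> nd (q :: G) r -> nd G r
| nd_raa G p : nd (fNot p :: G) fBot -> nd G p
| nd_allI G p : nd (map fsh G) p -> nd G (fAll p)
| nd_allE G p t : nd G (fAll p) -> nd G (inst t p)
| nd_exI G p t : nd G (inst t p) -> nd G (fEx p)
| nd_exE G p q : nd G (fEx p) -> nd (p :: map fsh G) (fsh q) -> nd G q
| nd_eqI G t : nd G (fEq t t)
| nd_eqE G p s t : nd G (fEq s t) -> nd G (inst s p) -> nd G (inst t p).

Definition provable (T : formula -> Prop) (p : formula) : Prop :=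
  exists2 G : seq formula, (forall q, q \in G -> T q) & nd G p.

(* Bounded quantifiers: the bound t lives outside the quantifier, so shifting
   it enforces that the quantified variable does not occur in it. *)
Definition exle (t : term) (p : formula) := fEx (Var 0 <= sh t /\ p)%fo.
Definition allle (t : term) (p : formula) := fAll (Var 0 <= sh t -> p)%fo.
Definition exlt (t : term) (p : formula) := exle t (Var 0 < sh t /\ p)%fo.
Definition alllt (t : term) (p : formula) := allle t (Var 0 < sh t -> p)%fo.

Inductive Delta0 : formula -> Prop :=
| Delta0_bot : Delta0 fBot
| Delta0_eq s t : Delta0 (fEq s t)
| Delta0_le s t : Delta0 (fLe s t)
| Delta0_and p q : Delta0 p -> Delta0 q -> Delta0 (fAnd p q)
| Delta0_or p q : Delta0 p -> Delta0 q -> Delta0 (fOr p q)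
| Delta0_imp p q : Delta0 p -> Delta0 q -> Delta0 (fImp p q)
| Delta0_exle t p : Delta0 p -> Delta0 (exle t p)
| Delta0_allle t p : Delta0 p -> Delta0 (allle t p).

Definition Pk (d : term) : formula := (0 < d /\ Vk d = d)%fo.

Definition exPle (t : term) (p : formula) := exle t (Pk (Var 0) /\ p)%fo.
Definition allPle (t : term) (p : formula) := allle t (Pk (Var 0) -> p)%fo.
Definition allPlt (t : term) (p : formula) := alllt t (Pk (Var 0) -> p)%fo.

Definition modeq (k : nat) (x y : term) : formula :=
  exle (x + y) (sh x = sh y + k * Var 0 \/ sh y = sh x + k * Var 0)%fo.

(* (x)_d = a; inside the two quantifiers, y is [Var 1] and z is [Var 0]. *)
Definition digit (x d : term) (a : nat) : formula :=
  (Pk d /\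
   exlt d (exle (sh x)
     (shn 2 x = Var 1 + a * shn 2 d + Var 0 /\
      (Var 0 = 0 \/ shn 2 d < Vk (Var 0)))))%fo.
Arguments digit x%_fo_scope d%_fo_scope a%_nat_scope.

(* In (Comp), p stands for phi(d, y_0, y_1, ...) with d = [Var 0] and
   y_i = [Var i.+1]; inside the quantifiers, d' is [Var 0], x is [Var 1], the
   outer d is [Var 2] and y_i is [Var i.+3]. *)
Definition comp_ax (p : formula) : formula :=
  let p' := fsubst (scons (Var 0) (fun i => Var i.+3)) p in
  (Pk (Var 0) ->
   exlt (Var 0) (allPlt (Var 1)
     ((digit (Var 1) (Var 0) 1 /\ p') \/ (digit (Var 1) (Var 0) 0 /\ ~ p'))))%fo.

Section ArithmeticTheory.
Variable k : nat.
Local Notation x := (Var 0).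
Local Notation y := (Var 1).
Local Notation z := (Var 2).
Local Notation one := (num 1).

Inductive Tk_axiom : formula -> Prop :=
| Add_comm : Tk_axiom (x + y = y + x)
| Add_assoc : Tk_axiom ((x + y) + z = x + (y + z))
| Add_cancel : Tk_axiom (x + z = y + z -> x = y)
| Add_0 : Tk_axiom (x + 0 = x)
| Add_le_refl : Tk_axiom (x <= x)
| Add_le_anti : Tk_axiom (x <= y /\ y <= x -> x = y)
| Add_le_trans : Tk_axiom (x <= y /\ y <= z -> x <= z)
| Add_le_total : Tk_axiom (x <= y \/ y <= x)
| Add_le_add : Tk_axiom (x <= y -> x + z <= y + z)
| Add_succ : Tk_axiom (Succ x = x + Succ 0)
| Add_discr : Tk_axiom (x < y <-> Succ x <= y)
| Ord0 : Tk_axiom (0 <= x)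
| Ord1 : Tk_axiom (x <= y <-> exle y (Var 0 + sh x = sh y))
| Mod : Tk_axiom (\big[fOr/fBot]_(0 <= a < k) modeq k x (num a))
| V0_0 : Tk_axiom (Vk 0 = 0)
| V0_1 : Tk_axiom (Vk one = one)
| V1_mul : Tk_axiom (Vk (k * x) = k * Vk x)
| V1_digit : Tk_axiom (Pk x -> \big[fAnd/fTop]_(1 <= a < k) (Vk (a * x) = x)%fo)
| V2 : Tk_axiom (0 < x /\ 0 < y /\ Vk x < Vk y -> Vk (x + y) = Vk x)
| V3 : Tk_axiom (0 < x ->
    exle x (\big[fOr/fBot]_(1 <= a < k)
      (sh x = Var 0 + a * Vk (sh x) /\ (Vk (sh x) < Vk (Var 0) \/ Var 0 = 0))%fo))
| V4 : Tk_axiom (0 < x -> exPle x (Var 0 <= sh x /\ sh x < k * Var 0))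
| V5 : Tk_axiom (Vk (Vk x) = Vk x)
| Comp p : Delta0 p -> Tk_axiom (comp_ax p).

Definition Tk (p : formula) : Prop := exists2 q, Tk_axiom q & p = closure q.

End ArithmeticTheory.

Record automaton (k m : nat) := Automaton {
  state : finType;
  init : state;
  accept : {set state};
  trans : {set state * m.-tuple 'I_k * state}
}.

Definition deterministic k m (A : automaton k m) : Prop :=
  forall (q : state A) (a : m.-tuple 'I_k), exists! q', (q, a, q') \in trans A.

Fixpoint exlt_block (n : nat) (t : term) (p : formula) : formula :=
  if n is n'.+1 then exlt t (exlt_block n' (sh t) p) else p.

(* W_{A,q1}(x_1, ..., x_m, d).  Below the block of quantifiers, w_q is the
   variable [w q]; below the further quantifier over d', which is then [Var 0],
   w_q becomes [sh (w q)]. *)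
Definition W k m (A : automaton k m) (q1 : state A) (x : 'I_m -> term)
    (d : term) : formula :=
  let n := #|state A| in
  let w (q : state A) := Var (enum_rank q) in
  (Pk d /\
   exlt_block n (k * d)
    (allPle (shn n d)
       (\big[fOr/fBot]_(q : state A)
          (digit (sh (w q)) (Var 0) 1 /\
           \big[fAnd/fTop]_(q' | q' != q) digit (sh (w q')) (Var 0) 0)%fo)
     /\ digit (w (init A)) (num 1) 1
     /\ digit (w q1) (shn n d) 1
     /\ allPlt (shn n d)
       (\big[fAnd/fTop]_(q : state A)
          (digit (sh (w q)) (Var 0) 1 ->
           \big[fOr/fBot]_(e in trans A | e.1.1 == q)
             (digit (sh (w e.2)) (k * Var 0) 1 /\
              \big[fAnd/fTop]_(i < m)
                digit (shn n.+1 (x i)) (Var 0) (tnth e.1.2 i)))%fo)))%fo.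

Definition graph_g (k n : nat) (x : 'I_n -> term) (d : term) : formula :=
  ((\big[fAnd/fTop]_(i < n) (x i = 0)%fo /\ d = num 1) \/
   (Pk d /\
    \big[fOr/fBot]_(i < n)
      (\big[fAnd/fTop]_(j < n) (x j <= x i)%fo /\ x i < d /\ d <= k * x i)%fo))%fo.

(* W_{A,q}(x, g(x)) *)
Definition Wg k m (A : automaton k m) (q : state A) (x : 'I_m -> term) : formula :=
  let x' i := sh (x i) in
  fEx (graph_g k x' (Var 0) /\ W q x' (Var 0))%fo.

(* Main.v *)
From HB Require Import structures.
From mathcomp Require Import all_boot.
From mathcomp Require Import boolp.
Require Import Defs.

(** The theorem is a statement about a proof calculus, but it is proved by
    reasoning about models.  By Goedel's completeness theorem
    ([completeness]) it suffices to find, for each formula, one automaton which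
    describes the formula in every model [M] of the theory; the automaton must
    not depend on [M].  This is the theorem of Buechi and Bruyere on the
    standard model, carried out in nonstandard ones.

    A model has nonstandard powers of [k], so runs may be infinitely long.  What
    replaces finite recursion is induction over the powers of [k] for properties
    definable by bounded formulas ([Pw_ind]): the comprehension scheme codes the
    set of counterexamples below some bound by the digits of a number [x], and
    [V x] is then the least counterexample.  Since every power other than [1] is
    [k] times a power and no power lies strictly between [e] and [k * e], the
    usual step from [d] to [k * d] is available.  It yields division with
    remainder by powers, with remainder [lo x d], and hence digits [dg x d].

    The formula W is bounded, so induction applies to it.  It says exactly
    that a run over the digits below [d] ends in the given state: it holds at
    [1] for the initial state ([Run_1]), and a run up to [k * d] is a run up to
    [d] followed by one transition ([Run_k]), because codes of runs can be
    truncated and prolonged by one digit.  Hence a deterministic automaton has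
    a well-defined state [st X d] after reading the digits of [X] below any
    power [d].

    A formula is recognizable if some automaton decides it in all models, where
    the run may stop at any power that exceeds all inputs.  Recognizable
    formulas are closed under Boolean operations (product automata), renaming
    and existential quantification ([recog_ex]).  For the latter the subset
    automaton tracks the states reachable by guessing the digits of the
    quantified variable; that variable may be longer than the others, so a set
    of states accepts if one of its elements can reach acceptance while the
    other tracks read zeros.  Reachability in the finite automaton, which takes
    standardly many steps, suffices also for nonstandard lengths, since the set
    of reachable states is closed under transitions ([connect_st]).  Only two
    atomic formulas need explicit automata, [x + y = z] ([recog_add]) and
    [V x = y] ([recog_val]); all others are first-order definable from these. *)

Set Implicit Arguments.
Unset Strict Implicit.
Unset Printing Implicit Defensive.

(** * Substitution *)

Definition up (s : nat -> term) := scons (Var 0) (fun i => sh (s i)).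

Lemma tsubst_comp s s' t :
  tsubst s (tsubst s' t) = tsubst (fun i => tsubst s (s' i)) t.
Proof. by elim: t => //= [t ->|t -> u ->|t ->]. Qed.

Lemma up_comp s s' :
  (fun i => tsubst (up s) (up s' i)) = up (fun i => tsubst s (s' i)).
Proof. by apply/funext => -[|i] //=; rewrite /shn !tsubst_comp. Qed.

Lemma fsubst_comp s s' p :
  fsubst s (fsubst s' p) = fsubst (fun i => tsubst s (s' i)) p.
Proof.
elim: p s s' => //=.
- by move=> t u s s'; rewrite !tsubst_comp.
- by move=> t u s s'; rewrite !tsubst_comp.
- by move=> p IHp q IHq s s'; rewrite IHp IHq.
- by move=> p IHp q IHq s s'; rewrite IHp IHq.
- by move=> p IHp q IHq s s'; rewrite IHp IHq.
- by move=> p IHp s s'; rewrite IHp -/(up s) -/(up s') up_comp.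
- by move=> p IHp s s'; rewrite IHp -/(up s) -/(up s') up_comp.
Qed.

Lemma tsubst_bound s s' t :
  (forall i, i < tbound t -> s i = s' i) -> tsubst s t = tsubst s' t.
Proof.
elim: t => //= [i ->//|t IH H|t IHt u IHu H|t IH H]; rewrite ?IH //.
by rewrite IHt ?IHu // => i Hi; apply: H; rewrite leq_max Hi ?orbT.
Qed.

Lemma fsubst_bound s s' p :
  (forall i, i < fbound p -> s i = s' i) -> fsubst s p = fsubst s' p.
Proof.
have bin (m n i : nat) : (i < m) || (i < n) -> i < maxn m n by rewrite leq_max.
elim: p s s' => //=.
- by move=> t u s s' H; congr fEq; apply: tsubst_bound => i Hi; apply: H;
    rewrite bin // Hi ?orbT.
- by move=> t u s s' H; congr fLe; apply: tsubst_bound => i Hi; apply: H;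
    rewrite bin // Hi ?orbT.
- by move=> p IHp q IHq s s' H; rewrite (IHp s s') ?(IHq s s') // => i Hi;
    apply: H; rewrite bin // Hi ?orbT.
- by move=> p IHp q IHq s s' H; rewrite (IHp s s') ?(IHq s s') // => i Hi;
    apply: H; rewrite bin // Hi ?orbT.
- by move=> p IHp q IHq s s' H; rewrite (IHp s s') ?(IHq s s') // => i Hi;
    apply: H; rewrite bin // Hi ?orbT.
- move=> p IHp s s' H; congr fAll; apply: IHp => -[|i] //= Hi.
  by rewrite H //; case: (fbound p) Hi.
- move=> p IHp s s' H; congr fEx; apply: IHp => -[|i] //= Hi.
  by rewrite H //; case: (fbound p) Hi.
Qed.

Lemma tsubst_id t : tsubst Var t = t.
Proof. by elim: t => //= [t ->|t -> u ->|t ->]. Qed.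

Lemma up_id : up Var = Var.
Proof. by apply/funext => -[|i]. Qed.

Lemma fsubst_id p : fsubst Var p = p.
Proof.
elim: p => //=.
- by move=> t u; rewrite !tsubst_id.
- by move=> t u; rewrite !tsubst_id.
- by move=> p -> q ->.
- by move=> p -> q ->.
- by move=> p -> q ->.
- by move=> p {2}<-; rewrite -/(up Var) up_id.
- by move=> p {2}<-; rewrite -/(up Var) up_id.
Qed.

Lemma fsubst_closed s p : fbound p = 0 -> fsubst s p = p.
Proof.
by move=> p0; rewrite -[RHS]fsubst_id; apply: fsubst_bound => i; rewrite p0.
Qed.

Lemma fsubst_inst s t p :
  fsubst s (inst t p) = inst (tsubst s t) (fsubst (up s) p).
Proof.
rewrite /inst !fsubst_comp; congr fsubst; apply/funext => -[|i] //=.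
by rewrite /shn tsubst_comp tsubst_id.
Qed.

Lemma fsubst_fsh s p : fsubst (up s) (fsh p) = fsh (fsubst s p).
Proof. by rewrite /fsh !fsubst_comp. Qed.

Lemma inst_up t s p : inst t (fsubst (up s) p) = fsubst (scons t s) p.
Proof.
rewrite /inst fsubst_comp; congr fsubst; apply/funext => -[|i] //=.
by rewrite /shn tsubst_comp tsubst_id.
Qed.

(** * Structural properties of natural deduction *)

Lemma nd_weak G G' p : nd G p -> {subset G <= G'} -> nd G' p.
Proof.
have consS (a : formula) (H H' : seq formula) :
  {subset H <= H'} -> {subset a :: H <= a :: H'}.
  by move=> HH q; rewrite !inE => /orP[->//|/HH ->]; rewrite orbT.
have mapS (H H' : seq formula) :
  {subset H <= H'} -> {subset map fsh H <= map fsh H'}.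
  by move=> HH q /mapP[r /HH rH ->]; apply: map_f.
move=> pf; elim: pf G' => {G p}.
- by move=> G p Gp G' /(_ _ Gp); apply: nd_ax.
- by move=> G p q _ IH G' GG'; apply/nd_impI/IH/consS.
- by move=> G p q _ IH1 _ IH2 G' GG'; apply: nd_impE (IH1 _ GG') (IH2 _ GG').
- by move=> G p q _ IH1 _ IH2 G' GG'; apply: nd_andI (IH1 _ GG') (IH2 _ GG').
- by move=> G p q _ IH G' GG'; apply: nd_andE1 (IH _ GG').
- by move=> G p q _ IH G' GG'; apply: nd_andE2 (IH _ GG').
- by move=> G p q _ IH G' GG'; apply: nd_orI1 (IH _ GG').
- by move=> G p q _ IH G' GG'; apply: nd_orI2 (IH _ GG').
- move=> G p q r _ IH _ IH1 _ IH2 G' GG'.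
  by apply: nd_orE (IH _ GG') (IH1 _ _) (IH2 _ _); apply: consS.
- by move=> G p _ IH G' GG'; apply/nd_raa/IH/consS.
- by move=> G p _ IH G' GG'; apply/nd_allI/IH/mapS.
- by move=> G p t _ IH G' GG'; apply/nd_allE/IH.
- by move=> G p t _ IH G' GG'; apply/nd_exI/IH.
- move=> G p q _ IH _ IH1 G' GG'.
  by apply: nd_exE (IH _ GG') (IH1 _ _); apply/consS/mapS.
- by move=> G t G' _; apply: nd_eqI.
- by move=> G p s t _ IH _ IH1 G' GG'; apply: nd_eqE (IH _ GG') (IH1 _ GG').
Qed.

Lemma nd_subst G p s : nd G p -> nd (map (fsubst s) G) (fsubst s p).
Proof.
have mapE (H : seq formula) (r : nat -> term) :
  map (fsubst (up r)) (map fsh H) = map fsh (map (fsubst r) H).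
  by rewrite -!map_comp; apply: eq_map => q /=; rewrite fsubst_fsh.
move=> pf; elim: pf s => {G p}.
- by move=> G p Gp s; apply/nd_ax/map_f.
- by move=> G p q _ IH s; apply/nd_impI/IH.
- by move=> G p q _ IH1 _ IH2 s; apply: nd_impE (IH1 s) (IH2 s).
- by move=> G p q _ IH1 _ IH2 s; apply: nd_andI (IH1 s) (IH2 s).
- by move=> G p q _ IH s; apply: nd_andE1 (IH s).
- by move=> G p q _ IH s; apply: nd_andE2 (IH s).
- by move=> G p q _ IH s; apply: nd_orI1 (IH s).
- by move=> G p q _ IH s; apply: nd_orI2 (IH s).
- by move=> G p q r _ IH _ IH1 _ IH2 s; apply: nd_orE (IH s) (IH1 s) (IH2 s).
- by move=> G p _ IH s; apply/nd_raa/IH.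
- by move=> G p _ IH s; apply: nd_allI; rewrite -mapE; apply: IH.
- by move=> G p t _ IH s; rewrite fsubst_inst; apply: nd_allE; apply: (IH s).
- move=> G p t _ IH s; apply: (@nd_exI _ _ (tsubst s t)).
  by rewrite -fsubst_inst; apply: IH.
- move=> G p q _ IH _ IH1 s; apply: nd_exE (IH s) _.
  by rewrite -mapE -fsubst_fsh; apply: (IH1 (up s)).
- by move=> G t s; apply: nd_eqI.
- move=> G p t u _ IH _ IH1 s; rewrite fsubst_inst.
  by apply: nd_eqE (IH s) _; rewrite -fsubst_inst; apply: IH1.
Qed.

(** * Tarskian semantics *)

Record structure := Structure {
  dom :> Type;
  s0 : dom;
  sS : dom -> dom;
  sP : dom -> dom -> dom;
  sV : dom -> dom;
  sle : dom -> dom -> Prop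
}.

Definition ext (X : Type) (a : X) (r : nat -> X) (i : nat) : X :=
  if i is j.+1 then r j else a.

Fixpoint eval (M : structure) (r : nat -> M) (t : term) : M :=
  match t with
  | Var i => r i
  | Zero => s0 M
  | Succ u => sS (eval r u)
  | Plus u v => sP (eval r u) (eval r v)
  | Vk u => sV (eval r u)
  end.

Fixpoint sat (M : structure) (r : nat -> M) (p : formula) : Prop :=
  match p with
  | fBot => False
  | fEq t u => eval r t = eval r u
  | fLe t u => sle (eval r t) (eval r u)
  | fAnd p q => sat r p /\ sat r q
  | fOr p q => sat r p \/ sat r q
  | fImp p q => sat r p -> sat r q
  | fAll p => forall a, sat (ext a r) p
  | fEx p => exists a, sat (ext a r) p
  end.

Lemma eval_subst (M : structure) (r : nat -> M) s t :
  eval r (tsubst s t) = eval (fun i => eval r (s i)) t.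
Proof. by elim: t => //= [t ->|t -> u ->|t ->]. Qed.

Lemma eval_shn (M : structure) (r : nat -> M) n t :
  eval r (shn n t) = eval (fun i => r (n + i)) t.
Proof. exact: eval_subst. Qed.

Lemma eval_up (M : structure) (r : nat -> M) a s :
  (fun i => eval (ext a r) (up s i)) = ext a (fun i => eval r (s i)).
Proof. by apply/funext => -[|i] //=; rewrite eval_shn. Qed.

Lemma sat_subst (M : structure) (r : nat -> M) s p :
  sat r (fsubst s p) <-> sat (fun i => eval r (s i)) p.
Proof.
elim: p r s => //=.
- by move=> t u r s; rewrite !eval_subst.
- by move=> t u r s; rewrite !eval_subst.
- by move=> p IHp q IHq r s; rewrite IHp IHq.
- by move=> p IHp q IHq r s; rewrite IHp IHq.
- by move=> p IHp q IHq r s; rewrite IHp IHq.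
- move=> p IH r s; rewrite -/(up s).
  by split=> H a; move: (H a); rewrite IH eval_up.
- move=> p IH r s; rewrite -/(up s).
  by split=> -[a H]; exists a; move: H; rewrite IH eval_up.
Qed.

Lemma sat_closure (M : structure) n p :
  (forall r : nat -> M, sat r (iter n fAll p)) <-> (forall r : nat -> M, sat r p).
Proof.
split; last by elim: n => //= n IH H r a; apply: IH.
elim: n => //= n IH H; apply: IH => r; move: (H (fun i => r i.+1) (r 0)).
by congr sat; apply/funext => -[].
Qed.

(** * Completeness of natural deduction *)

HB.instance Definition _ := gen_choiceMixin term.

(** From a maximal consistent set of formulas with witnesses to a model whose
    elements are terms up to provable equality. *)
Section TermModel.

Variable Om : formula -> Prop.
Hypothesis Om_nd : forall H p, nd H p -> (forall q, q \in H -> Om q) -> Om p.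
Hypothesis Om_con : ~ Om fBot.
Hypothesis Om_max : forall p, Om p \/ Om (fNot p).
Hypothesis Om_wit : forall p, Om (fEx p) -> exists t, Om (inst t p).

Lemma Om_nd0 p : nd [::] p -> Om p.
Proof. by move=> pf; apply: (Om_nd pf). Qed.

Lemma Om_nd1 p q : nd [:: p] q -> Om p -> Om q.
Proof. by move=> pf Op; apply: (Om_nd pf) => r; rewrite inE => /eqP->. Qed.

Lemma Om_nd2 p q r : nd [:: p; q] r -> Om p -> Om q -> Om r.
Proof.
by move=> pf Op Oq; apply: (Om_nd pf) => u; rewrite !inE => /orP[] /eqP->.
Qed.

Lemma nd_hd p G : nd (p :: G) p.
Proof. by apply: nd_ax; rewrite inE eqxx. Qed.

Lemma nd_hd2 p q G : nd (p :: q :: G) q.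
Proof. by apply: nd_ax; rewrite !inE eqxx orbT. Qed.

Lemma tsubst_scons_sh u t : tsubst (scons u Var) (sh t) = t.
Proof. by rewrite /shn tsubst_comp -[RHS]tsubst_id. Qed.

Lemma Om_leibniz s t p : Om (fEq s t) -> Om (inst s p) -> Om (inst t p).
Proof. by apply: Om_nd2; apply: nd_eqE (nd_hd _ _) (nd_hd2 _ _ _). Qed.

Definition teq (t u : term) : bool := `[< Om (fEq t u) >].

Lemma teq_refl : reflexive teq.
Proof. by move=> t; apply/asboolP/Om_nd0/nd_eqI. Qed.

Lemma teq_sym : symmetric teq.
Proof.
have imp t u : teq t u -> teq u t.
  move=> /asboolP tu; apply/asboolP.
  have := @Om_leibniz t u (fEq (Var 0) (sh t)) tu.
  by rewrite /inst /= !tsubst_scons_sh; apply; apply/asboolP/teq_refl.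
by move=> t u; apply/idP/idP; apply: imp.
Qed.

Lemma teq_trans : transitive teq.
Proof.
move=> u t v /asboolP tu /asboolP uv; apply/asboolP.
have := @Om_leibniz u v (fEq (sh t) (Var 0)) uv.
by rewrite /inst /= !tsubst_scons_sh; apply.
Qed.

(** The canonical representative of the class of a term: [xchoose] only looks
    at the extension of the predicate, hence it sends equal classes to the same
    term. *)
Lemma teq_ex t : exists u, teq t u.
Proof. by exists t; apply: teq_refl. Qed.

Definition rep (t : term) : term := xchoose (teq_ex t).

Lemma teq_rep t : teq t (rep t).
Proof. exact: (xchooseP (teq_ex t)). Qed.

Lemma repP t u : reflect (rep t = rep u) (teq t u).
Proof.
apply: (iffP idP) => [tu|E]; last first.
  by apply: teq_trans (teq_rep t) _; rewrite E teq_sym teq_rep.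
apply: eq_xchoose => v; apply/idP/idP => H; last exact: teq_trans tu H.
by apply: teq_trans H; rewrite teq_sym.
Qed.

Lemma rep_idem t : rep (rep t) = rep t.
Proof. by apply/esym/repP/teq_rep. Qed.

Definition tdom := {t : term | rep t == t}.
Definition cl (t : term) : tdom := exist _ (rep t) (introT eqP (rep_idem t)).

Lemma clP t u : cl t = cl u <-> Om (fEq t u).
Proof.
split=> [[/repP /asboolP //]|/asboolP /repP E].
exact: val_inj.
Qed.

Lemma cl_val (a : tdom) : cl (val a) = a.
Proof. by apply: val_inj; apply/eqP: (valP a). Qed.

Lemma Om_rep t : Om (fEq t (rep t)).
Proof. exact/asboolP/teq_rep. Qed.

Definition term_model : structure := {|
  dom := tdom;
  s0 := cl Zero;
  sS a := cl (Succ (val a));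
  sP a b := cl (Plus (val a) (val b));
  sV a := cl (Vk (val a));
  sle a b := Om (fLe (val a) (val b)) |}.

Lemma Om_cong p t u : Om (fEq t u) -> Om (inst t p) <-> Om (inst u p).
Proof.
move=> tu; split; apply: Om_leibniz => //.
by move: tu => /asboolP; rewrite -/(teq _ _) teq_sym => /asboolP.
Qed.

Lemma eval_term_model s t :
  @eval term_model (fun i => cl (s i)) t = cl (tsubst s t).
Proof.
elim: t => //= [t ->|t -> u ->|t ->]; apply/clP => /=.
- have := (@Om_cong (fEq (Succ (Var 0)) (Succ (sh (tsubst s t)))) _ _
    (Om_rep (tsubst s t))).
  by rewrite /inst /= !tsubst_scons_sh => <-; apply: Om_nd0; apply: nd_eqI.
- have := (@Om_cong (fEq (Plus (Var 0) (sh (tsubst s u)))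
    (sh (Plus (tsubst s t) (tsubst s u)))) _ _ (Om_rep (tsubst s t))).
  have := (@Om_cong (fEq (Plus (sh (rep (tsubst s t))) (Var 0))
    (sh (Plus (tsubst s t) (tsubst s u)))) _ _ (Om_rep (tsubst s u))).
  rewrite /inst /= !tsubst_scons_sh => <- <-.
  by apply: Om_nd0; apply: nd_eqI.
- have := (@Om_cong (fEq (Vk (Var 0)) (Vk (sh (tsubst s t)))) _ _
    (Om_rep (tsubst s t))).
  by rewrite /inst /= !tsubst_scons_sh => <-; apply: Om_nd0; apply: nd_eqI.
Qed.

Lemma Om_not p : Om (fNot p) <-> ~ Om p.
Proof.
split=> [np p1|np]; last by case: (Om_max p).
apply: Om_con; apply: Om_nd2 np p1.
exact: nd_impE (nd_hd _ _) (nd_hd2 _ _ _).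
Qed.

Lemma nd_not_all p : nd [:: fNot (fAll p)] (fEx (fNot p)).
Proof.
apply: nd_raa; apply: nd_impE (nd_hd2 _ _ _) _.
apply/nd_allI/nd_raa => /=.
apply: nd_impE (nd_hd2 _ _ _) _.
apply: (@nd_exI _ _ (Var 0)).
have -> : inst (Var 0) (fsubst (up (fun i => Var i.+1)) (fNot p)) = fNot p.
  rewrite inst_up -[RHS]fsubst_id; congr fsubst.
  by apply/funext => -[].
exact: nd_hd.
Qed.

(** Truth in the term model is membership in [Om].  The substitution is general
    because an instance of the body of a quantified formula is not a subformula,
    but is the same subformula under another substitution. *)
Lemma sat_term_model s p :
  @sat term_model (fun i => cl (s i)) p <-> Om (fsubst s p).
Proof.
have extE t r : ext (cl t) (fun i => cl (r i)) = (fun i => cl (scons t r i)).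
  by apply/funext => -[].
elim: p s => //=.
- by move=> t u s; rewrite !eval_term_model clP.
- move=> t u s; rewrite !eval_term_model /=.
  have := (@Om_cong (fLe (Var 0) (sh (tsubst s u))) _ _ (Om_rep (tsubst s t))).
  have := (@Om_cong (fLe (sh (rep (tsubst s t))) (Var 0)) _ _
    (Om_rep (tsubst s u))).
  by rewrite /inst /= !tsubst_scons_sh => <- <-.
- move=> p IHp q IHq s; rewrite IHp IHq; split=> [[]|pq].
    by apply: Om_nd2; apply: nd_andI (nd_hd _ _) (nd_hd2 _ _ _).
  split; move: pq; apply: Om_nd1.
    exact: nd_andE1 (nd_hd _ _).
  exact: nd_andE2 (nd_hd _ _).
- move=> p IHp q IHq s; rewrite IHp IHq; split=> [[|]|pq].
  + by apply: Om_nd1; apply/nd_orI1/nd_hd.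
  + by apply: Om_nd1; apply/nd_orI2/nd_hd.
  + case: (Om_max (fsubst s p)) => [|np]; first by left.
    right; move: pq np; apply: Om_nd2.
    apply: nd_orE (nd_hd _ _) _ _; last exact: nd_hd.
    apply: nd_raa; apply: nd_impE (nd_ax (p := fNot (fsubst s p)) _) _.
      by rewrite !inE eqxx !orbT.
    exact: nd_hd2.
- move=> p IHp q IHq s; rewrite IHp IHq; split=> [pq|]; last first.
    by apply: Om_nd2; apply: nd_impE (nd_hd _ _) (nd_hd2 _ _ _).
  case: (Om_max (fsubst s p)) => [/pq|].
    by apply: Om_nd1; apply/nd_impI/nd_hd2.
  apply: Om_nd1; apply/nd_impI/nd_raa.
  apply: nd_impE (nd_ax (p := fNot (fsubst s p)) _) (nd_hd2 _ _ _).
  by rewrite !inE eqxx !orbT.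
- move=> p IH s; rewrite -/(up s); split=> H; last first.
    move=> a; rewrite -(cl_val a) extE IH -inst_up.
    by move: H; apply: Om_nd1; apply/nd_allE/nd_hd.
  case: (Om_max (fAll (fsubst (up s) p))) => // /(Om_nd1 (nd_not_all _)).
  move=> /Om_wit[t]; rewrite /inst /= -/(fNot _) Om_not -/(inst _ _) inst_up.
  by rewrite -IH -extE => /(_ (H (cl t))).
- move=> p IH s; rewrite -/(up s); split=> [[a]|/Om_wit[t]].
    rewrite -(cl_val a) extE IH -inst_up; apply: Om_nd1.
    exact: nd_exI (nd_hd _ _).
  by rewrite inst_up -IH -extE; exists (cl t).
Qed.

End TermModel.

(** Formulas are enumerated by encoding them into countable trees. *)
Fixpoint term_tree (t : term) : GenTree.tree nat :=
  match t with
  | Var i => GenTree.Leaf i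
  | Zero => GenTree.Node 0 [::]
  | Succ u => GenTree.Node 1 [:: term_tree u]
  | Plus u v => GenTree.Node 2 [:: term_tree u; term_tree v]
  | Vk u => GenTree.Node 3 [:: term_tree u]
  end.

Fixpoint tree_term (t : GenTree.tree nat) : term :=
  match t with
  | GenTree.Leaf i => Var i
  | GenTree.Node 1 [:: u] => Succ (tree_term u)
  | GenTree.Node 2 [:: u; v] => Plus (tree_term u) (tree_term v)
  | GenTree.Node 3 [:: u] => Vk (tree_term u)
  | _ => Zero
  end.

Lemma term_treeK : cancel term_tree tree_term.
Proof. by elim=> //= [t ->|t -> u ->|t ->]. Qed.

Fixpoint formula_tree (p : formula) : GenTree.tree nat :=
  match p with
  | fBot => GenTree.Node 0 [::]
  | fEq t u => GenTree.Node 1 [:: term_tree t; term_tree u]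
  | fLe t u => GenTree.Node 2 [:: term_tree t; term_tree u]
  | fAnd p q => GenTree.Node 3 [:: formula_tree p; formula_tree q]
  | fOr p q => GenTree.Node 4 [:: formula_tree p; formula_tree q]
  | fImp p q => GenTree.Node 5 [:: formula_tree p; formula_tree q]
  | fAll p => GenTree.Node 6 [:: formula_tree p]
  | fEx p => GenTree.Node 7 [:: formula_tree p]
  end.

Fixpoint tree_formula (t : GenTree.tree nat) : formula :=
  match t with
  | GenTree.Node 1 [:: t; u] => fEq (tree_term t) (tree_term u)
  | GenTree.Node 2 [:: t; u] => fLe (tree_term t) (tree_term u)
  | GenTree.Node 3 [:: p; q] => fAnd (tree_formula p) (tree_formula q)
  | GenTree.Node 4 [:: p; q] => fOr (tree_formula p) (tree_formula q)
  | GenTree.Node 5 [:: p; q] => fImp (tree_formula p) (tree_formula q)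
  | GenTree.Node 6 [:: p] => fAll (tree_formula p)
  | GenTree.Node 7 [:: p] => fEx (tree_formula p)
  | _ => fBot
  end.

Lemma formula_treeK : cancel formula_tree tree_formula.
Proof.
by elim=> //= [t u|t u|p -> q ->|p -> q ->|p -> q ->|p ->|p ->] //;
  rewrite !term_treeK.
Qed.

Definition formula_nth (n : nat) : formula :=
  if unpickle n is Some t then tree_formula t else fBot.

Lemma formula_nthP p : formula_nth (pickle (formula_tree p)) = p.
Proof. by rewrite /formula_nth pickleK formula_treeK. Qed.

(** The members of [T] are closed, so that free variables can serve as Henkin
    constants and the language need not be extended. *)
Section Henkin.

Variables (T : formula -> Prop) (phi : formula).
Hypothesis T_closed : forall p, T p -> fbound p = 0.
Hypothesis T_phi : ~ provable T phi.

Definition derivable (L : seq formula) (p : formula) : Prop :=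
  exists2 G, (forall q, q \in G -> T q) & nd (L ++ G) p.

Lemma derivable_weak L L' p :
  {subset L <= L'} -> derivable L p -> derivable L' p.
Proof.
move=> LL' [G TG pf]; exists G => //; apply: nd_weak pf _ => q.
by rewrite !mem_cat => /orP[/LL' ->//|->]; rewrite orbT.
Qed.

Lemma derivable_mp L p q :
  derivable L (fImp p q) -> derivable L p -> derivable L q.
Proof.
move=> [G TG pf] [G' TG' pf']; exists (G ++ G').
  by move=> r; rewrite mem_cat => /orP[/TG|/TG'].
by apply: nd_impE (nd_weak pf _) (nd_weak pf' _) => r;
  rewrite !mem_cat => /orP[] ->; rewrite ?orbT.
Qed.

Lemma derivable_not L p : derivable (p :: L) fBot -> derivable L (fNot p).
Proof. by case=> G TG pf; exists G => //; apply/nd_impI. Qed.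

Definition fresh (L : seq formula) : nat := \max_(p <- L) fbound p.

Lemma fresh_bound L p : p \in L -> fbound p <= fresh L.
Proof. by move=> pL; rewrite /fresh (big_rem p) //= leq_maxl. Qed.

(** A fresh variable serves as a witness because it can be renamed into the
    variable bound by the existential quantifier. *)
Lemma derivable_fresh L p : fEx p \in L ->
  derivable (inst (Var (fresh L)) p :: L) fBot -> derivable L fBot.
Proof.
set y := fresh L => pL [G TG pf]; exists G => //.
have bL q : q \in L ++ G -> fbound q <= y.
  by rewrite mem_cat => /orP[/fresh_bound //|/TG /T_closed ->].
pose s i := if i == y then Var 0 else Var i.+1.
have ys q : fbound q <= y -> fsubst s q = fsh q.
  move=> qy; apply: fsubst_bound => i iq; rewrite /s ifN //.
  by rewrite neq_ltn (leq_trans iq qy).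
apply: (@nd_exE _ p); first by apply: nd_ax; rewrite mem_cat pL.
have {pf} := nd_subst s pf; rewrite /= -/(fsh fBot).
have -> : fsubst s (inst (Var y) p) = p.
  rewrite fsubst_inst inst_up -[RHS]fsubst_id; apply: fsubst_bound.
  case=> [|i] ip /=; first by rewrite /s eqxx.
  rewrite /s ifN // neq_ltn; apply/orP; left.
  by apply: leq_trans (fresh_bound pL) => /=; case: (fbound p) ip.
have -> // : map (fsubst s) (L ++ G) = map fsh (L ++ G).
by apply/eq_in_map => q /bL /ys.
Qed.

(** Together with a consistent existential formula a witness is added at once.
    A formula that is skipped is refutable, so completeness of the limit needs
    no separate step for the negation. *)
Definition henkin_step (L : seq formula) (p : formula) : seq formula :=
  if `[< derivable (p :: L) fBot >] then L
  else if p is fEx q then inst (Var (fresh (p :: L))) q :: p :: L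
  else p :: L.

Fixpoint henkin (n : nat) : seq formula :=
  if n is m.+1 then henkin_step (henkin m) (formula_nth m) else [:: fNot phi].

Lemma henkin_step_sub L p : {subset L <= henkin_step L p}.
Proof.
rewrite /henkin_step => q qL; case: asboolP => // _.
by case: p => *; rewrite !inE qL ?orbT.
Qed.

Lemma henkin_sub n m : n <= m -> {subset henkin n <= henkin m}.
Proof.
move=> /subnKC <-; elim: (m - n) => [|d IH] q qn; rewrite ?addn0 //.
by rewrite addnS; apply/henkin_step_sub/IH.
Qed.

Lemma henkin_con n : ~ derivable (henkin n) fBot.
Proof.
elim: n => [|n IH] /=.
  case=> G TG pf; apply: T_phi; exists G => //; exact: nd_raa.
rewrite /henkin_step; case: asboolP => // con.
case: (formula_nth n) con => // p con /derivable_fresh H; apply: con.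
by apply: H; rewrite inE eqxx.
Qed.

Definition Om (p : formula) : Prop := exists n, derivable (henkin n) p.

Lemma Om_mp p q : Om (fImp p q) -> Om p -> Om q.
Proof.
move=> [n Hn] [m Hm]; exists (maxn n m).
apply: derivable_mp (derivable_weak _ Hn) (derivable_weak _ Hm);
  apply: henkin_sub; [exact: leq_maxl|exact: leq_maxr].
Qed.

Lemma Om_nd H p : nd H p -> (forall q, q \in H -> Om q) -> Om p.
Proof.
elim: H p => [|q H IH] p pf OH.
  by exists 0, [::] => //; apply: nd_weak pf _.
apply: (@Om_mp q); last by apply: OH; rewrite inE eqxx.
by apply: IH (nd_impI pf) _ => r rH; apply: OH; rewrite inE rH orbT.
Qed.

Lemma Om_con : ~ Om fBot.
Proof. by case=> n /henkin_con. Qed.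

Lemma henkin_stage p : exists n,
  derivable (p :: henkin n) fBot \/
  henkin n.+1 = if p is fEx q then inst (Var (fresh (p :: henkin n))) q
                                   :: p :: henkin n
                else p :: henkin n.
Proof.
exists (pickle (formula_tree p)).
rewrite [henkin _.+1]/= formula_nthP /henkin_step.
by case: asboolP => H; [left|right].
Qed.

Lemma derivable_mem L p : p \in L -> derivable L p.
Proof. by move=> pL; exists [::] => //; apply: nd_ax; rewrite cats0. Qed.

Lemma Om_max p : Om p \/ Om (fNot p).
Proof.
case: (henkin_stage p) => n [/derivable_not H|E]; first by right; exists n.
left; exists n.+1; rewrite E; apply: derivable_mem.
by case: (p) => *; rewrite ?mem_head // in_cons mem_head orbT.
Qed.

Lemma Om_wit p : Om (fEx p) -> exists t, Om (inst t p).
Proof.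
move=> Op; case: (henkin_stage (fEx p)) => n [/derivable_not H|E]; last first.
  exists (Var (fresh (fEx p :: henkin n))), n.+1; rewrite E.
  by apply: derivable_mem; rewrite mem_head.
by case: Om_con; apply: Om_mp Op; exists n.
Qed.

Lemma henkin_model : exists (M : structure) (r : nat -> M),
  (forall p, T p -> forall r' : nat -> M, sat r' p) /\ ~ sat r phi.
Proof.
exists (term_model Om_nd), (fun i => cl Om_nd (Var i)).
have satE := sat_term_model Om_nd Om_con Om_max Om_wit.
split=> [p Tp r|/satE]; last first.
  rewrite fsubst_id; apply/(Om_not Om_nd Om_con Om_max).
  by exists 0; apply: derivable_mem; rewrite inE eqxx.
have -> : r = fun i => cl Om_nd (val (r i)).
  by apply/funext => i; rewrite cl_val.
rewrite satE fsubst_closed; last exact: T_closed.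
exists 0, [:: p]; first by move=> q; rewrite inE => /eqP ->.
exact: nd_hd2.
Qed.

End Henkin.

Theorem completeness (T : formula -> Prop) (p : formula) :
  (forall q, T q -> fbound q = 0) ->
  (forall M : structure, (forall q, T q -> forall r : nat -> M, sat r q) ->
     forall r : nat -> M, sat r p) ->
  provable T p.
Proof.
move=> Tc Tp; apply: contrapT => /(henkin_model Tc)[M [r [MT]]].
by apply; apply: Tp.
Qed.

(** * Satisfaction of the abbreviations *)

Lemma eval_sh (M : structure) (r : nat -> M) a t :
  eval (ext a r) (sh t) = eval r t.
Proof. exact: eval_shn. Qed.

Lemma eval_sh2 (M : structure) (r : nat -> M) a b t :
  eval (ext a (ext b r)) (shn 2 t) = eval r t.
Proof. exact: eval_shn. Qed.

(** A classical description operator with a default value. *)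
Definition pickp (X : Type) (x0 : X) (P : X -> Prop) : X :=
  match pselect (exists x, P x) with
  | left H => projT1 (cid H)
  | right _ => x0
  end.

Lemma pickpP (X : Type) (x0 : X) (P : X -> Prop) :
  (exists x, P x) -> P (pickp x0 P).
Proof. by rewrite /pickp; case: pselect => // H _; case: cid. Qed.

Definition models (k : nat) (M : structure) : Prop :=
  forall p, Tk_axiom k p -> forall r : nat -> M, sat r p.

Declare Scope model_scope.
Delimit Scope model_scope with M.
Notation "0" := (s0 _) : model_scope.
Notation "x + y" := (sP x y) : model_scope.
Notation "x <= y" := (sle x y) : model_scope.
Definition lt (M : structure) (x y : M) : Prop := sle x y /\ ~ x = y.
Notation "x < y" := (lt x y) : model_scope.
Definition mul (M : structure) (n : nat) (x : M) : M := iter n (sP x) (s0 M).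
Notation "n * x" := (mul n x) : model_scope.
Definition one (M : structure) : M := sS (s0 M).
Arguments one {M}.
Notation "1" := one : model_scope.
Arguments mul {M} n%_nat_scope x%_M.
Arguments lt {M} x%_M y%_M.
Arguments sle {s} _%_M _%_M.
Arguments sP {s} _%_M _%_M.
Arguments sV {s} _%_M.

Lemma eval_tmul (M : structure) (r : nat -> M) n t :
  eval r (tmul n t) = mul n (eval r t).
Proof. by elim: n => //= n ->. Qed.

Lemma sat_bigorP (M : structure) (r : nat -> M) (I : eqType) (s : seq I) P F :
  sat r (\big[fOr/fBot]_(i <- s | P i) F i) <->
  exists i, [/\ i \in s, P i & sat r (F i)].
Proof.
elim: s => [|i s IH]; first by rewrite big_nil; split=> [[]|[i []]].
rewrite big_cons; split.
  have tl : sat r (\big[fOr/fBot]_(j <- s | P j) F j) ->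
      exists j, [/\ j \in i :: s, P j & sat r (F j)].
    by move=> /IH[j [js Pj Fj]]; exists j; rewrite inE js orbT.
  case: ifP => [Pi /= [Fi|/tl //]|_ /tl //].
  by exists i; rewrite mem_head.
case=> j []; rewrite inE => /orP[/eqP -> -> Fi|js Pj Fj]; first by left.
have H : sat r (\big[fOr/fBot]_(j <- s | P j) F j) by apply/IH; exists j.
by case: ifP => _ //; right.
Qed.

Lemma sat_bigandP (M : structure) (r : nat -> M) (I : eqType) (s : seq I) P F :
  sat r (\big[fAnd/fTop]_(i <- s | P i) F i) <->
  forall i, i \in s -> P i -> sat r (F i).
Proof.
elim: s => [|i s IH]; first by rewrite big_nil; split=> // _ i.
rewrite big_cons; split=> [H j|H].
  have tl : sat r (\big[fAnd/fTop]_(j <- s | P j) F j).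
    by move: H; case: ifP => // _ [].
  rewrite inE => /orP[/eqP -> Pi|js Pj].
    by move: H; rewrite Pi => -[].
  by move/IH: tl; apply.
have tl : sat r (\big[fAnd/fTop]_(j <- s | P j) F j).
  by apply/IH => j js; apply: H; rewrite inE js orbT.
by case: ifP => // Pi; split=> //; apply: H; rewrite ?mem_head.
Qed.

Lemma sat_exle (M : structure) (r : nat -> M) t p :
  sat r (exle t p) <-> exists a, (a <= eval r t)%M /\ sat (ext a r) p.
Proof.
rewrite -[sat r (exle t p)]/(exists a : M,
  (a <= eval (ext a r) (sh t))%M /\ sat (ext a r) p).
by split=> -[a H]; exists a; move: H; rewrite eval_sh.
Qed.

Lemma sat_lt (M : structure) (r : nat -> M) t u :
  sat r (fLt t u) <-> (eval r t < eval r u)%M.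
Proof. by []. Qed.

Lemma sat_imp (M : structure) (r : nat -> M) p q :
  sat r (fImp p q) <-> (sat r p -> sat r q).
Proof. by []. Qed.

Lemma sat_and (M : structure) (r : nat -> M) p q :
  sat r (fAnd p q) <-> sat r p /\ sat r q.
Proof. by []. Qed.

Lemma sat_ex (M : structure) (r : nat -> M) p :
  sat r (fEx p) <-> exists a, sat (ext a r) p.
Proof. by []. Qed.

Lemma sat_eq (M : structure) (r : nat -> M) t u :
  sat r (fEq t u) <-> eval r t = eval r u.
Proof. by []. Qed.

Lemma sat_or (M : structure) (r : nat -> M) p q :
  sat r (fOr p q) <-> sat r p \/ sat r q.
Proof. by []. Qed.

Lemma sat_exlt (M : structure) (r : nat -> M) t p :
  sat r (exlt t p) <-> exists a, (a < eval r t)%M /\ sat (ext a r) p.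
Proof.
rewrite sat_exle; split=> -[a]; last first.
  move=> [lta H]; exists a; split; first by case: lta.
  by split=> //; apply/sat_lt; rewrite eval_sh.
by move=> [_ [/sat_lt + H]]; rewrite eval_sh; exists a.
Qed.

Lemma sat_allle (M : structure) (r : nat -> M) t p :
  sat r (allle t p) <-> forall a, (a <= eval r t)%M -> sat (ext a r) p.
Proof.
rewrite -[sat r (allle t p)]/(forall a : M,
  (a <= eval (ext a r) (sh t))%M -> sat (ext a r) p).
by split=> H a; move: (H a); rewrite eval_sh.
Qed.

Lemma sat_alllt (M : structure) (r : nat -> M) t p :
  sat r (alllt t p) <-> forall a, (a < eval r t)%M -> sat (ext a r) p.
Proof.
rewrite sat_allle; split=> H a lta; last first.
  by move/sat_lt; rewrite eval_sh; apply: H.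
apply: H; first by case: lta.
by apply/sat_lt; rewrite eval_sh.
Qed.

(** * Arithmetic in a model of the theory *)

(** Identities of the commutative monoid are decided by comparing the multisets
    of the atoms of both sides. *)
Inductive mexp : Type := MAtom of nat | MZero | MPlus of mexp & mexp.

Fixpoint mflat (e : mexp) : seq nat :=
  match e with
  | MAtom i => [:: i]
  | MZero => [::]
  | MPlus e f => mflat e ++ mflat f
  end.

Fixpoint mden (M : structure) (env : seq M) (e : mexp) : M :=
  match e with
  | MAtom i => nth (s0 M) env i
  | MZero => s0 M
  | MPlus e f => sP (mden env e) (mden env f)
  end.

Ltac mem_in x l :=
  lazymatch l with
  | nil => false
  | cons x _ => true
  | cons _ ?l' => mem_in x l'
  end.
Ltac atoms_of t l :=
  lazymatch t with
  | s0 _ => l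
  | sP ?a ?b => let l' := atoms_of a l in atoms_of b l'
  | ?x => lazymatch mem_in x l with true => l | false => constr:(cons x l) end
  end.
Ltac index_of x l :=
  lazymatch l with
  | cons x _ => constr:(O)
  | cons _ ?l' => let n := index_of x l' in constr:(S n)
  end.
Ltac reify_m t l :=
  lazymatch t with
  | s0 _ => constr:(MZero)
  | sP ?a ?b => let a' := reify_m a l in let b' := reify_m b l in
                constr:(MPlus a' b')
  | ?x => let n := index_of x l in constr:(MAtom n)
  end.

Ltac abel_with L :=
  lazymatch goal with
  | |- ?a = ?b =>
    let T := type of a in
    let l := atoms_of a (@nil T) in
    let l := atoms_of b l in
    let ea := reify_m a l in
    let eb := reify_m b l in
    exact: (L l ea eb erefl)
  end.

(** The formula [y = x mod d], for a power [d]. *)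
Definition fLo (x d y : term) : formula :=
  (y < d /\ exle x (sh x = sh y + Var 0 /\
     (Var 0 = Zero \/ sh d <= Vk (Var 0))))%fo.

Lemma Delta0_fLo x d y : Delta0 (fLo x d y).
Proof. by do ! constructor. Qed.

Section Arith.

Variables (k : nat) (M : structure).
Hypothesis hk : (1 < k)%N.
Hypothesis HM : models k M.
Implicit Types x y z u v d e : M.
Local Open Scope model_scope.

Let env x y z : nat -> M := ext x (ext y (fun _ => z)).

Lemma addC x y : x + y = y + x.
Proof. exact: (HM (Add_comm k) (env x y y)). Qed.
Lemma addA x y z : x + (y + z) = x + y + z.
Proof. exact: esym (HM (Add_assoc k) (env x y z)). Qed.
Lemma addI z x y : x + z = y + z -> x = y.
Proof. exact: (HM (Add_cancel k) (env x y z)). Qed.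
Lemma addx0 x : x + 0 = x.
Proof. exact: (HM (Add_0 k) (env x x x)). Qed.
Lemma add0x x : 0 + x = x.
Proof. by rewrite addC addx0. Qed.

Lemma msum_rem (en : seq M) i s : i \in s ->
  foldr (fun j => sP (nth 0 en j)) 0 s =
  nth 0 en i + foldr (fun j => sP (nth 0 en j)) 0 (rem i s).
Proof.
elim: s => //= j s IH; rewrite inE eq_sym; case: eqP => [->//|_ /= si].
by rewrite (IH si) !addA (addC (nth 0 en i)).
Qed.

Lemma msum_perm (en : seq M) s t : perm_eq s t ->
  foldr (fun j => sP (nth 0 en j)) 0 s = foldr (fun j => sP (nth 0 en j)) 0 t.
Proof.
elim: s t => [|i s IH] t st.
  by move: st; rewrite perm_sym => /perm_nilP ->.
have it : i \in t by rewrite -(perm_mem st) mem_head.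
rewrite (msum_rem _ it) /=; congr sP; apply: IH.
by rewrite -(perm_cons i) (perm_trans st) // perm_to_rem.
Qed.

Lemma mden_flat (en : seq M) (e : mexp) :
  mden en e = foldr (fun j => sP (nth 0 en j)) 0 (mflat e).
Proof.
elim: e => //= [i|e -> f ->]; first by rewrite addx0.
by elim: (mflat e) => /= [|i s IH]; rewrite ?add0x // -addA IH.
Qed.

Lemma abelP (en : seq M) (e f : mexp) :
  perm_eq (mflat e) (mflat f) -> mden en e = mden en f.
Proof. by rewrite !mden_flat; apply: msum_perm. Qed.

Ltac abel := abel_with (@abelP).

Lemma le_refl x : x <= x.
Proof. exact: (HM (Add_le_refl k) (env x x x)). Qed.
Lemma le_anti x y : x <= y -> y <= x -> x = y.
Proof. by move=> xy yx; apply: (HM (Add_le_anti k) (env x y x)). Qed.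
Lemma le_trans y x z : x <= y -> y <= z -> x <= z.
Proof. by move=> xy yz; apply: (HM (Add_le_trans k) (env x y z)). Qed.
Lemma le_total x y : x <= y \/ y <= x.
Proof. exact: (HM (Add_le_total k) (env x y x)). Qed.
Lemma le_addr z x y : x <= y -> x + z <= y + z.
Proof. exact: (HM (Add_le_add k) (env x y z)). Qed.
Lemma succE x : sS x = x + 1.
Proof. exact: (HM (Add_succ k) (env x x x)). Qed.
Lemma lt_succ x y : x < y <-> x + 1 <= y.
Proof.
by rewrite -succE; case: (HM (Add_discr k) (env x y x)) => H1 H2; split.
Qed.
Lemma le0x x : 0 <= x.
Proof. exact: (HM (Ord0 k) (env x x x)). Qed.
Lemma le_ex x y : x <= y -> exists z, z + x = y.
Proof. by case: (HM (Ord1 k) (env x y x)) => H _ /H[z [_ /= E]]; exists z. Qed.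

Lemma ltW x y : x < y -> x <= y.
Proof. by case. Qed.
Lemma lt_irr x : ~ x < x.
Proof. by case. Qed.
Lemma lt_le_trans y x z : x < y -> y <= z -> x < z.
Proof.
move=> [xy nxy] yz; split; first exact: le_trans yz.
by move=> xz; apply: nxy; apply: le_anti => //; rewrite xz.
Qed.
Lemma le_lt_trans y x z : x <= y -> y < z -> x < z.
Proof.
move=> xy [yz nyz]; split; first exact: le_trans yz.
by move=> xz; apply: nyz; apply: le_anti => //; rewrite -xz.
Qed.
Lemma le_or_lt x y : x <= y \/ y < x.
Proof.
case: (pselect (x = y)) => [->|nxy]; first by left; apply: le_refl.
by case: (le_total x y) => H; [left|right; split=> // /esym].
Qed.
Lemma lt_not_le x y : x < y -> ~ y <= x.
Proof. by move=> xy yx; apply: (@lt_irr x); apply: lt_le_trans yx. Qed.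
Lemma lt0 x : 0 < x <-> x <> 0.
Proof.
split=> [[_ nx] /esym //|nx].
by split; [exact: le0x | exact: nesym].
Qed.
Lemma zero_or_pos x : x = 0 \/ 0 < x.
Proof. by case: (pselect (x = 0)) => [|/lt0]; [left|right]. Qed.

Lemma le_addl z x y : x <= y -> z + x <= z + y.
Proof. by rewrite !(addC z); apply: le_addr. Qed.
Lemma leD x y z u : x <= y -> z <= u -> x + z <= y + u.
Proof. by move=> xy zu; apply: le_trans (le_addr _ xy) (le_addl _ zu). Qed.
Lemma le_addx x y : x <= x + y.
Proof. by rewrite -{1}(addx0 x); apply/le_addl/le0x. Qed.
Lemma le_addrI z x y : x + z <= y + z -> x <= y.
Proof.
move=> H; case: (le_or_lt x y) => // yx; exfalso.
by case: yx => yx; apply; apply: (@addI z); apply: le_anti => //; apply: le_addr.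
Qed.
Lemma lt_addr z x y : x < y -> x + z < y + z.
Proof.
by move=> [xy nxy]; split; [exact: le_addr | move=> /addI].
Qed.
Lemma lt_addrI z x y : x + z < y + z -> x < y.
Proof. by case=> /le_addrI xy nxy; split=> // E; apply: nxy; rewrite E. Qed.
Lemma ltD x y z u : x < y -> z <= u -> x + z < y + u.
Proof. by move=> xy zu; apply: lt_le_trans (lt_addr _ xy) (le_addl _ zu). Qed.

(** Certificates for linear inequalities: [s <= t] follows from a sum [x <= y]
    of hypotheses and a nonnegative slack [u]. *)
Lemma le_by u x y s t : x <= y -> s + y + u = t + x -> s <= t.
Proof.
move=> xy E; apply: (@le_addrI x); rewrite -E.
exact: le_trans (le_addl _ xy) (le_addx _ _).
Qed.
Lemma lt_by u x y s t : x < y -> s + y + u = t + x -> s < t.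
Proof.
move=> xy E; apply: (@lt_addrI x); rewrite -E.
by apply: lt_le_trans (le_addx _ _); rewrite !(addC s); apply: lt_addr.
Qed.
Lemma absurd_by u x y : x < y -> y + u = x -> False.
Proof. by move=> xy E; apply: (lt_not_le xy); rewrite -E; apply: le_addx. Qed.

Lemma lt01 : 0 < (1 : M).
Proof. by apply/lt_succ; rewrite add0x; apply: le_refl. Qed.
Lemma lt1 x : x < 1 -> x = 0.
Proof.
move=> /lt_succ H; apply: le_anti (le0x _).
by apply: (le_by (u := 0) H); abel.
Qed.
Lemma pos_ge1 x : 0 < x -> 1 <= x.
Proof. by move=> /lt_succ; rewrite add0x. Qed.
Lemma add_eq0 x y : x + y = 0 -> x = 0.
Proof. by move=> E; apply: le_anti (le0x _); rewrite -E; apply: le_addx. Qed.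
Lemma le_eq0 x : x <= 0 -> x = 0.
Proof. by move=> H; apply: le_anti (le0x _). Qed.

Lemma mulS n x : n.+1 * x = x + n * x.
Proof. by []. Qed.
Lemma mul1 x : 1%N * x = x.
Proof. exact: addx0. Qed.
Lemma mulnDl m n x : (m + n)%N * x = m * x + n * x.
Proof. by elim: m => [|m IH]; rewrite ?add0x // addSn !mulS IH addA. Qed.
Lemma muln0 n : n * 0 = 0 :> M.
Proof. by elim: n => [|n IH] //; rewrite mulS IH addx0. Qed.
Lemma mulnM m n x : (m * n)%N * x = m * (n * x).
Proof. by elim: m => [|m IH] //; rewrite mulSn mulnDl IH. Qed.
Lemma mul_le n x y : x <= y -> n * x <= n * y.
Proof. by move=> xy; elim: n => [|n IH]; [exact: le_refl | exact: leD]. Qed.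
Lemma mul_lt n x y : (0 < n)%N -> x < y -> n * x < n * y.
Proof. by case: n => // n _ xy; apply: ltD => //; apply/mul_le/ltW. Qed.
Lemma mul_inj n x y : (0 < n)%N -> n * x = n * y -> x = y.
Proof.
move=> n0 E; apply: le_anti; [case: (le_or_lt x y)|case: (le_or_lt y x)] => //
  /(mul_lt n0); by rewrite E => /lt_irr.
Qed.
Lemma mul_lel m n x : (m <= n)%N -> m * x <= n * x.
Proof. by move=> /subnKC <-; rewrite mulnDl; apply: le_addx. Qed.
Lemma mul_ge n x : (0 < n)%N -> x <= n * x.
Proof. by move=> n0; rewrite -{1}(mul1 x); apply: mul_lel. Qed.
Lemma mul_eq0 n x : (0 < n)%N -> n * x = 0 -> x = 0.
Proof. by move=> n0 E; apply/le_eq0; rewrite -E; apply: mul_ge. Qed.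
Lemma mul_pos n x : (0 < n)%N -> 0 < x -> 0 < n * x.
Proof. by move=> n0 x0; apply: lt_le_trans x0 (mul_ge _ n0). Qed.
Lemma mul_ltl m n x : (m < n)%N -> 0 < x -> m * x < n * x.
Proof.
move=> mn x0; apply: lt_le_trans (mul_lel x mn).
by rewrite mulS; apply: (lt_by (u := 0) x0); abel.
Qed.

(** ** Powers of the base *)

Definition Pw d : Prop := 0 < d /\ sV d = d.

Lemma k_gt0 : (0 < k)%N. Proof. exact: ltnW. Qed.

Lemma eval_num r n : @eval M r (num n) = n * 1.
Proof. by elim: n => //= n ->; rewrite succE addC. Qed.

Lemma mod_ex x : exists a z, (a < k)%N /\
  (x = a * 1 + k * z \/ a * 1 = x + k * z).
Proof.
have /sat_bigorP[a [ak _]] := HM (Mod k) (env x x x).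
rewrite mem_index_iota in ak; case/sat_exle => z [_] /=.
by rewrite !eval_sh !eval_tmul !eval_num /=; exists a, z.
Qed.

Lemma V0 : sV 0 = 0 :> M.
Proof. exact: (HM (V0_0 k) (env 0 0 0)). Qed.
Lemma V1 : sV 1 = 1 :> M.
Proof. exact: (HM (V0_1 k) (env 0 0 0)). Qed.
Lemma Vmul x : sV (k * x) = k * sV x.
Proof. by have := HM (V1_mul k) (env x x x); rewrite /= !eval_tmul. Qed.
Lemma Vdig a d : Pw d -> (0 < a < k)%N -> sV (a * d) = d.
Proof.
move=> Pd ak; have /sat_imp/(_ Pd) := HM (V1_digit k) (env d d d).
move=> /sat_bigandP/(_ a); rewrite mem_index_iota /= eval_tmul /=.
exact.
Qed.
Lemma Vadd x y : 0 < x -> 0 < y -> sV x < sV y -> sV (x + y) = sV x.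
Proof. by move=> x0 y0 xy; apply: (HM (V2 k) (env x y x)). Qed.
Lemma V3_ex x : 0 < x -> exists y a, [/\ (0 < a < k)%N, x = y + a * sV x &
  y = 0 \/ sV x < sV y].
Proof.
move=> x0; have /sat_imp/(_ x0)/sat_exle[y [_]] := HM (V3 k) (env x x x).
case/sat_bigorP => a [+ _]; rewrite mem_index_iota /= !eval_tmul /= => ak [E H].
by exists y, a; split=> //; case: H; [right|left].
Qed.
Lemma V4_ex x : 0 < x -> exists d, [/\ Pw d, d <= x & x < k * d].
Proof.
move=> x0; have /sat_imp/(_ x0)/sat_exle[d [_ [Pd]]] := HM (V4 k) (env x x x).
by rewrite /= eval_tmul => -[]; exists d.
Qed.
Lemma VV x : sV (sV x) = sV x.
Proof. exact: (HM (V5 k) (env x x x)). Qed.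

(** If [V x = 0], the digit expansion of axiom V3 would say [x = y] with [y]
    zero or of larger valuation than [x]. *)
Lemma Vpos x : 0 < x -> 0 < sV x.
Proof.
move=> x0; case: (zero_or_pos (sV x)) => // Vx0; exfalso.
case: (V3_ex x0) => y [a [_ E H]]; move: E.
rewrite Vx0 muln0 addx0 => E; case: H => [y0|].
  by move: x0; rewrite E y0 => /lt_irr.
by rewrite E => /lt_irr.
Qed.
Lemma Vle x : sV x <= x.
Proof.
case: (zero_or_pos x) => [->|x0]; first by rewrite V0; apply: le_refl.
case: (V3_ex x0) => y [a [/andP[a0 _] E _]]; rewrite {2}E addC.
exact: le_trans (mul_ge _ a0) (le_addx _ _).
Qed.
Lemma PwV x : 0 < x -> Pw (sV x).
Proof. by move=> x0; split; [exact: Vpos | exact: VV]. Qed.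
Lemma Pw1 : Pw 1.
Proof. by split; [exact: lt01 | exact: V1]. Qed.
Lemma Pwk d : Pw d -> Pw (k * d).
Proof.
by move=> [d0 Vd]; split; [exact: mul_pos k_gt0 d0 | rewrite Vmul Vd].
Qed.
Lemma lt_kd d : 0 < d -> d < k * d.
Proof. by move=> d0; rewrite -{1}(mul1 d); apply: mul_ltl. Qed.

(** No power lies strictly between [e] and [k * e]: otherwise write the
    difference as [y + a * e] with [y] zero or of larger valuation; then
    [V f = V (a.+1 * e) = e]. *)
Lemma Pw_gap e f : Pw e -> Pw f -> e < f -> k * e <= f.
Proof.
move=> [e0 Ve] [f0 Vf] ef; case: (le_ex (ltW ef)) => g E.
have g0 : 0 < g by apply/lt0 => g0; move: ef; rewrite -E g0 add0x => /lt_irr.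
have Vg : sV g = e.
  apply: le_anti.
    case: (le_or_lt (sV g) e) => // eg; exfalso.
    have : sV (e + g) = sV e by apply: Vadd => //; rewrite Ve.
    by rewrite addC E Ve Vf => fe; move: ef; rewrite fe => /lt_irr.
  case: (le_or_lt e (sV g)) => // ge; exfalso.
  have : sV (g + e) = sV g by apply: Vadd => //; rewrite Ve.
  rewrite E Vf => fg; move: ge; rewrite -fg => fe.
  by apply: lt_irr (lt_le_trans ef (ltW fe)).
case: (V3_ex g0) => y [a [/andP[a0 ak] Eg H]]; rewrite Vg in Eg H.
have fE : f = a.+1 * e + y by rewrite -E Eg mulS; abel.
case: (ltnP a.+1 k) => [ak1|ka]; last first.
  by rewrite fE; apply: le_trans (mul_lel _ ka) (le_addx _ _).
have Vae : sV (a.+1 * e) = e by apply: Vdig; rewrite ?ak1.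
exfalso; have : sV f = e.
  rewrite fE; case: H => [->|ey]; first by rewrite addx0.
  rewrite Vadd ?Vae //; first exact: mul_pos.
  by apply: lt_le_trans (Vle y); apply: le_lt_trans ey; apply: le0x.
by rewrite Vf => fe; move: ef; rewrite fe => /lt_irr.
Qed.

(** Write [d = a + k * z].  If the digit [a] is not zero then [V d = 1], and
    otherwise [z] is the power sought. *)
Lemma Pw_pred d : Pw d -> d = 1 \/ exists2 e, Pw e & d = k * e.
Proof.
move=> [d0 Vd]; case: (mod_ex d) => a [z [ak H]].
have Va : (0 < a)%N -> sV (a * 1) = 1 :> M.
  by move=> a0; apply: Vdig; [exact: Pw1 | rewrite a0].
case: H => [E|E]; last first.
  case: (zero_or_pos z) => [z0|z0]; last first.
    exfalso; apply: (@lt_irr (k * 1)).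
    apply: le_lt_trans (mul_ltl ak lt01); rewrite E.
    apply: le_trans (mul_le k (pos_ge1 z0)) _.
    by rewrite addC; apply: le_addx.
  move: E; rewrite z0 muln0 addx0 => E; left; rewrite -Vd -E; apply: Va.
  by case: a E {ak} => // E; move: d0; rewrite -E => /lt_irr.
case: (posnP a) => [a0|a0].
  right; exists z; last by rewrite E a0 add0x.
  have E' : d = k * z by rewrite E a0 add0x.
  split.
    by apply/lt0 => z0; move: d0; rewrite E' z0 muln0 => /lt_irr.
  by apply: (@mul_inj k); rewrite ?k_gt0 // -Vmul -E'.
left; rewrite -Vd E; case: (zero_or_pos z) => [->|z0].
  by rewrite muln0 addx0; apply: Va.
rewrite Vadd ?Va //; [exact: (mul_pos a0 lt01)|exact: (mul_pos k_gt0)|].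
rewrite Vmul; apply: lt_le_trans (lt_kd lt01) _.
by apply/mul_le/pos_ge1/Vpos.
Qed.

(** ** Division by powers and digits *)

(** This expresses that the power [d] divides [z]. *)
Definition high d z : Prop := z = 0 \/ d <= sV z.

(** Adding a multiple of [d] to a positive number below [d] does not change the
    valuation of the latter. *)
Lemma high_add d u z : 0 < u -> u < d -> high d z -> sV (u + z) < d.
Proof.
move=> u0 ud [->|dz]; first by rewrite addx0; apply: le_lt_trans (Vle u) ud.
have Vud : sV u < d by apply: le_lt_trans (Vle u) ud.
rewrite Vadd //; last exact: lt_le_trans dz.
apply/lt0 => z0; move: dz; rewrite z0 V0; apply: lt_not_le.
exact: le_lt_trans (le0x _) ud.
Qed.

Lemma high_k d z : Pw d -> (z = 0 \/ d < sV z) <-> high (k * d) z.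
Proof.
move=> Pd; case: (zero_or_pos z) => [z0|z0]; first by split=> _; left.
have [_ nz] := z0; have {}nz : z <> 0 by apply: nesym.
split=> -[//|H]; right; first by apply: Pw_gap => //; apply: PwV.
by apply: lt_le_trans H; apply: lt_kd; case: Pd.
Qed.

Lemma high_le d e z : d <= e -> high e z -> high d z.
Proof. by move=> de [->|H]; [left | right; apply: le_trans H]. Qed.

(** The remainder is unique because the difference of two remainders has
    valuation less than [d]. *)
Lemma split_uniq d y z y' z' : y < d -> y' < d -> high d z -> high d z' ->
  y + z = y' + z' -> y = y'.
Proof.
have key u v w t : u <= v -> v < d -> high d w -> high d t ->
    u + w = v + t -> u = v.
  move=> uv vd hw ht; case: (le_ex uv) => s E; rewrite -E => E'.
  have {}E' : w = s + t.
    by apply: (@addI u); rewrite addC E'; abel.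
  case: (zero_or_pos s) => [->|s0]; first by rewrite add0x.
  have sd : s < d by apply: le_lt_trans vd; rewrite -E; apply: le_addx.
  have := high_add s0 sd ht; rewrite -E' => wd.
  case: hw => [w0|dw]; last by case: (lt_not_le wd dw).
  by move: E'; rewrite w0 => /esym /add_eq0 s0'; move: s0; rewrite s0' => /lt_irr.
move=> yd yd' hz hz' E; case: (le_total y y') => H; first exact: key E.
by apply/esym; apply: key (esym E).
Qed.

Definition isLo x d y : Prop := y < d /\ exists2 z, x = y + z & high d z.

Definition lo x d : M := pickp x (isLo x d).

Lemma lo_uniq x d y : isLo x d y -> lo x d = y.
Proof.
move=> H; have /(pickpP x) : exists y, isLo x d y by exists y.
rewrite -/(lo x d); case: H => yd [z E hz] [yd' [z' E' hz']].
by apply: split_uniq hz' hz _ => //; rewrite -E'.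
Qed.

(** The digit relation of the language, read in the model. *)
Definition Dig x d a : Prop := Pw d /\ exists y z,
  [/\ y < d, x = y + a * d + z & z = 0 \/ d < sV z].

Lemma sat_digit (r : nat -> M) (x d : term) a :
  sat r (digit x d a) <-> Dig (eval r x) (eval r d) a.
Proof.
have satE : sat r (digit x d a) <-> (Pw (eval r d) /\ sat r (exlt d (exle (sh x)
     (shn 2 x = Var 1 + a * shn 2 d + Var 0 /\
      (Var 0 = Zero \/ shn 2 d < Vk (Var 0)))))%fo) by [].
rewrite satE {satE}; split=> -[Pd H]; split=> //.
  move/sat_exlt: H => [y [yd /sat_exle[z [_]]]].
  rewrite /= !eval_tmul !eval_sh2 => -[E H].
  by exists y, z.
case: H => y [z [yd E H]]; apply/sat_exlt; exists y; split=> //.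
apply/sat_exle; exists z; rewrite /= !eval_tmul !eval_sh2 eval_sh; split=> //.
by rewrite E addC; apply: le_addx.
Qed.

Lemma add_mul_lt y a d e : y < d -> (a < k)%N -> e = k * d -> y + a * d < e.
Proof.
move=> yd ak ->; apply: lt_le_trans (mul_lel d ak); rewrite mulS.
exact: lt_addr.
Qed.

Lemma digit_eq d y y' a b : y < d -> y' < d -> y + a * d = y' + b * d -> a = b.
Proof.
have key m n u v : u < d -> (m < n)%N -> u + m * d = v + n * d -> False.
  move=> ud /subnKC <-; rewrite addSnnS mulnDl mulS => E.
  apply: (@absurd_by (v + (n - m.+1) * d) _ _ ud).
  by apply: (@addI (m * d)); rewrite E; abel.
move=> yd yd' E; case: (ltngtP a b) => // ab; exfalso.
  exact: key yd ab E.
exact: key yd' ab (esym E).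
Qed.

Lemma Dig_uniq x d a b : (a < k)%N -> (b < k)%N ->
  Dig x d a -> Dig x d b -> a = b.
Proof.
move=> ak bk [Pd [y [z [yd E H]]]] [_ [y' [z' [yd' E' H']]]].
apply: (digit_eq yd yd').
apply: (split_uniq (add_mul_lt yd ak erefl) (add_mul_lt yd' bk erefl)
  (proj1 (high_k z Pd) H) (proj1 (high_k z' Pd) H')).
by rewrite -E -E'.
Qed.

(** Induction over the powers of [k].  The set of counterexamples is coded by
    a number [x], and [V x] is the least of them. *)
Lemma Pw_ind p (r : nat -> M) : Delta0 p -> sat (ext 1 r) p ->
  (forall d, Pw d -> sat (ext d r) p -> sat (ext (k * d) r) p) ->
  forall d, Pw d -> sat (ext d r) p.
Proof.
move=> Dp p1 pS d Pd; apply: contrapT => npd.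
have Dn : Delta0 (fNot p) by do ! constructor.
have /sat_imp/(_ (Pwk Pd)) := HM (Comp k Dn) (ext (k * d) r).
case/sat_exlt => x [xd] /sat_alllt Hx.
have {}Hx e : e < k * d -> Pw e ->
    (Dig x e 1 /\ ~ sat (ext e r) p) \/ (Dig x e 0 /\ sat (ext e r) p).
  have envE : (fun i => eval (ext e (ext x (ext (k * d) r)))
      (scons (Var 0) (fun i => Var i.+3) i)) = ext e r.
    by apply/funext => -[].
  move=> ed Pe; move: (Hx e ed) => /sat_imp/(_ Pe)/sat_or.
  case=> /sat_and[/sat_digit D].
    by move/sat_subst; rewrite envE => ne; left.
  move=> ne; right; split=> //; apply: contrapT => npe; apply: ne.
  by apply/sat_subst; rewrite envE.
have ltdk := lt_kd (proj1 Pd).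
have x0 : 0 < x.
  apply/lt0 => x0; case: (Hx _ ltdk Pd) => -[]; last by [].
  case=> _ [y [z [_]]]; rewrite x0 mul1 => E _ _.
  have : d = 0.
    apply/(@add_eq0 _ (y + z)); rewrite E; abel.
  by move=> d0; case: Pd; rewrite d0 => /lt_irr.
have Pe := PwV x0; set e := sV x in Pe *.
have ed : e < k * d by apply: le_lt_trans xd; apply: Vle.
have npe : ~ sat (ext e r) p.
  case: (Hx _ ed Pe) => -[] // D _.
  case: (V3_ex x0) => y [a [/andP[a0 ak] E H]].
  have : a = 0%N.
    apply: (@Dig_uniq x e) => //; first exact: k_gt0.
    split=> //; exists 0, y; split=> //; first by case: Pe.
    by rewrite {1}E -/e; abel.
  by move=> a0'; move: a0; rewrite a0'.
case: (Pw_pred Pe) => [e1|[f Pf ef]]; first by apply: npe; rewrite e1.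
have fe : f < e by rewrite ef; apply: lt_kd; case: Pf.
apply: npe; rewrite ef; apply: pS => //.
case: (Hx f _ Pf); [exact: lt_le_trans fe (ltW ed)| |by case].
case=> -[_ [y [z [yf E H]]]] _; exfalso.
have f0 := proj1 Pf.
have h : high e z by rewrite ef; apply/(high_k _ Pf).
have yfe : y + f < e.
  rewrite ef; apply: lt_le_trans (mul_lel f hk); rewrite mulS mul1.
  exact: lt_addr.
have yf0 : 0 < y + f by apply: lt_le_trans f0 _; rewrite addC; apply: le_addx.
have := high_add yf0 yfe h.
by move: E; rewrite mul1 => <- /lt_irr.
Qed.


Lemma sat_fLo (r : nat -> M) (x d y : term) :
  sat r (fLo x d y) <-> isLo (eval r x) (eval r d) (eval r y).
Proof.
rewrite sat_and sat_lt; split=> -[yd H]; split=> //.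
  by case/sat_exle: H => z [_ /=]; rewrite !eval_sh => -[E H]; exists z.
case: H => z E H; apply/sat_exle; exists z; split.
  by rewrite E addC; apply: le_addx.
by rewrite /= !eval_sh.
Qed.

(** Division with remainder by induction over the divisor: if [x = y + z] at [e]
    and [V z = e], then axiom V3 moves the leading digit of [z] from the
    quotient part to the remainder. *)
Lemma loP x d : Pw d -> isLo x d (lo x d).
Proof.
move=> Pd; apply: (@pickpP _ x (isLo x d)).
pose p := exle (Var 1) (fLo (Var 2) (Var 1) (Var 0)).
have satE e : sat (ext e (fun _ => x)) p <-> exists y, isLo x e y.
  rewrite sat_exle; split=> -[y]; first by case=> _ /sat_fLo; exists y.
  move=> H; exists y; split; last exact/sat_fLo.
  by case: H => _ [z -> _]; apply: le_addx.
apply/satE; apply: Pw_ind Pd; first by do ! constructor.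
  apply/satE; exists 0; split; first exact: lt01.
  exists x; first by rewrite add0x.
  by case: (zero_or_pos x) => [|/Vpos/pos_ge1]; [left|right].
move=> e Pe /satE[y [ye [z E hz]]]; apply/satE.
have e0 := proj1 Pe.
have y0 : isLo x e y by split=> //; exists z.
case: (pselect (z = 0 \/ e < sV z)) => [hk'|nh].
  exists y; split; first exact: lt_le_trans (mul_ge _ k_gt0).
  by exists z => //; apply/(high_k _ Pe).
have z0 : 0 < z by apply/lt0 => z0; apply: nh; left.
have Vz : sV z = e.
  case: hz => [z0'|]; first by case: nh; left.
  by move=> ez; apply: contrapT => nez; apply: nh; right; split=> // /esym.
case: (V3_ex z0) => t [a [/andP[a0 ak] Ez Ht]]; rewrite Vz in Ez Ht.
exists (y + a * e); split; first exact: add_mul_lt.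
exists t; last exact/(high_k _ Pe).
by rewrite E Ez; abel.
Qed.

Lemma lo_lt x d : Pw d -> lo x d < d.
Proof. by case/(loP x). Qed.

Lemma lo_le x d : Pw d -> lo x d <= x.
Proof. by move=> /(loP x)[_ [z {2}-> _]]; apply: le_addx. Qed.

Lemma lo_small x d : x < d -> lo x d = x.
Proof.
by move=> xd; apply: lo_uniq; split=> //; exists 0; rewrite ?addx0 //; left.
Qed.

(** The digit of [x] at [d], read off from two consecutive remainders. *)
Definition dg x d : nat :=
  pickp 0%N (fun a => (a < k)%N /\ lo x (k * d) = lo x d + a * d).

Lemma dgP x d : Pw d -> (dg x d < k)%N /\ lo x (k * d) = lo x d + dg x d * d.
Proof.
move=> Pd; rewrite /dg.
apply: (@pickpP _ 0%N (fun a => (a < k)%N /\ lo x (k * d) = lo x d + a * d)).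
case: (loP x Pd) => yd [z E hz].
case: (pselect (z = 0 \/ d < sV z)) => [h|nh].
  exists 0%N; split; first exact: k_gt0.
  rewrite addx0; apply: lo_uniq; split.
    exact: lt_le_trans yd (mul_ge _ k_gt0).
  by exists z => //; apply/(high_k _ Pd).
have z0 : 0 < z by apply/lt0 => z0; apply: nh; left.
have Vz : sV z = d.
  case: hz => [z0'|]; first by case: nh; left.
  by move=> ez; apply: contrapT => nez; apply: nh; right; split=> // /esym.
case: (V3_ex z0) => t [a [/andP[a0 ak] Ez Ht]]; rewrite Vz in Ez Ht.
exists a; split=> //; apply: lo_uniq; split; first exact: add_mul_lt.
exists t; last exact/(high_k _ Pd).
by rewrite {1}E Ez; abel.
Qed.

Lemma dg_lt x d : Pw d -> (dg x d < k)%N.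
Proof. by case/(dgP x). Qed.

Lemma lo_k x d : Pw d -> lo x (k * d) = lo x d + dg x d * d.
Proof. by case/(dgP x). Qed.

Lemma dg_uniq x d a : Pw d -> lo x (k * d) = lo x d + a * d -> dg x d = a.
Proof.
by move=> Pd; rewrite lo_k // => /digit_eq; apply; apply: lo_lt.
Qed.

Lemma Dig_dg x d a : (a < k)%N -> Dig x d a <-> Pw d /\ dg x d = a.
Proof.
move=> ak; split=> [[Pd [y [z [yd E H]]]]|[Pd <-]]; split=> //.
  apply: dg_uniq => //.
  have -> : lo x d = y.
    apply: lo_uniq; split=> //; exists (a * d + z); first by rewrite E; abel.
    case: (posnP a) => [->|a0].
      by rewrite add0x; apply: high_le (proj1 (high_k z Pd) H); apply: mul_ge k_gt0.
    right; have Va : sV (a * d) = d by apply: Vdig => //; rewrite a0.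
    case: H => [->|dz]; first by rewrite addx0 Va; apply: le_refl.
    rewrite Vadd ?Va //; first exact: le_refl.
      by apply: mul_pos => //; case: Pd.
    by apply: lt_le_trans (Vle z); apply: le_lt_trans dz; apply: le0x.
  apply: lo_uniq; split; first exact: add_mul_lt.
  by exists z => //; apply/(high_k _ Pd).
have [yd [z E hz]] := loP x (Pwk Pd).
exists (lo x d), z; split; [exact: lo_lt | by rewrite -lo_k | exact/high_k].
Qed.

(** Truncation at [e] leaves the digits below [e] unchanged.  The sum of the
    parts [h] and [z] cut off at [d] and at [e] is divisible by [d] by axiom V2,
    since [V h <= h < e <= V z]. *)
Lemma lo_lo x d e : Pw d -> Pw e -> d <= e -> lo (lo x e) d = lo x d.
Proof.
move=> Pd Pe de; apply/esym/lo_uniq.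
have [xe [z Ez hz]] := loP x Pe.
have [yd [h Eh hh]] := loP (lo x e) Pd.
split=> //; exists (h + z); first by rewrite {1}Ez {1}Eh; abel.
case: (zero_or_pos h) => [->|h0]; first by rewrite add0x; apply: high_le hz.
case: hz => [->|ez]; first by rewrite addx0.
have z0 : 0 < z.
  by apply: lt_le_trans (Vle z); apply: lt_le_trans ez; case: Pe.
right; rewrite Vadd //.
  by case: hh h0 => // -> /lt_irr.
apply: lt_le_trans ez; apply: le_lt_trans (Vle h) _.
by apply: le_lt_trans xe; rewrite Eh addC; apply: le_addx.
Qed.

Lemma dg_lo x d e : Pw d -> Pw e -> d < e -> dg (lo x e) d = dg x d.
Proof.
move=> Pd Pe de; apply: dg_uniq => //.
by rewrite !lo_lo ?lo_k //; [exact: ltW | exact: Pwk | exact: Pw_gap].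
Qed.

Lemma dg_small x d : Pw d -> x < d -> dg x d = 0%N.
Proof.
move=> Pd xd; apply: dg_uniq => //; rewrite addx0 !lo_small //.
exact: lt_le_trans (mul_ge _ k_gt0).
Qed.

Lemma lo_extend x d a : Pw d -> x < d -> (a < k)%N -> lo (x + a * d) d = x.
Proof.
move=> Pd xd ak; apply: lo_uniq; split=> //; exists (a * d) => //.
case: (posnP a) => [->|a0]; first by left.
by right; rewrite Vdig ?a0 //; apply: le_refl.
Qed.

Lemma dg_extend x d a : Pw d -> x < d -> (a < k)%N -> dg (x + a * d) d = a.
Proof.
move=> Pd xd ak; apply: dg_uniq => //; rewrite lo_extend // lo_small //.
exact: add_mul_lt.
Qed.

Lemma lo1 x : lo x 1 = 0.
Proof. exact/lt1/lo_lt/Pw1. Qed.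

Lemma Pw_ge1 d : Pw d -> 1 <= d.
Proof. by case=> /pos_ge1. Qed.

Lemma Pw_le_k d e : Pw d -> Pw e -> e <= k * d -> e <= d \/ e = k * d.
Proof.
move=> Pd Pe ekd; case: (le_or_lt e d); first by left.
by move=> /(Pw_gap Pd Pe) kde; right; apply: le_anti.
Qed.

Lemma Pw_lt_k d e : Pw d -> Pw e -> e < k * d -> e <= d.
Proof.
move=> Pd Pe ekd; have [//|E] := Pw_le_k Pd Pe (ltW ekd).
by move: ekd; rewrite E => /lt_irr.
Qed.

End Arith.

(** * Bounded formulas *)

Lemma Delta0_subst s p : Delta0 p -> Delta0 (fsubst s p).
Proof.
have upsh r t : tsubst (up r) (sh t) = sh (tsubst r t).
  by rewrite /shn !tsubst_comp.
move=> Dp; elim: Dp s => {p} /=; try by intros; constructor.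
  move=> t p _ IH s; rewrite -/(up s) -/(sh t) upsh.
  exact: (Delta0_exle (tsubst s t) (IH (up s))).
move=> t p _ IH s; rewrite -/(up s) -/(sh t) upsh.
exact: (Delta0_allle (tsubst s t) (IH (up s))).
Qed.

Lemma Delta0_top : Delta0 fTop.
Proof. by do ! constructor. Qed.

Lemma Delta0_exlt t p : Delta0 p -> Delta0 (exlt t p).
Proof. by move=> Dp; do ! constructor. Qed.

Lemma Delta0_alllt t p : Delta0 p -> Delta0 (alllt t p).
Proof. by move=> Dp; do ! constructor. Qed.

Lemma Delta0_digit x d a : Delta0 (digit x d a).
Proof. by do ! constructor. Qed.

Lemma Delta0_bigor (I : Type) (s : seq I) (P : pred I) F :
  (forall i, Delta0 (F i)) -> Delta0 (\big[fOr/fBot]_(i <- s | P i) F i).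
Proof.
move=> DF; apply: (big_ind Delta0) => //; first exact: Delta0_bot.
exact: Delta0_or.
Qed.

Lemma Delta0_bigand (I : Type) (s : seq I) (P : pred I) F :
  (forall i, Delta0 (F i)) -> Delta0 (\big[fAnd/fTop]_(i <- s | P i) F i).
Proof.
move=> DF; apply: (big_ind Delta0) => //; first exact: Delta0_top.
exact: Delta0_and.
Qed.

Lemma Delta0_block n t p : Delta0 p -> Delta0 (exlt_block n t p).
Proof. by move=> Dp; elim: n t => //= n IH t; apply: Delta0_exlt. Qed.

Lemma Delta0_W k m (A : automaton k m) (q : state A) x d : Delta0 (W q x d).
Proof.
apply: Delta0_and; first by do ! constructor.
apply/Delta0_block/Delta0_and.
  apply/Delta0_allle/Delta0_imp; first by do ! constructor.
  apply: Delta0_bigor => q'; apply/Delta0_and; first exact: Delta0_digit.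
  by apply: Delta0_bigand => q''; apply: Delta0_digit.
apply: Delta0_and; first exact: Delta0_digit.
apply: Delta0_and; first exact: Delta0_digit.
apply/Delta0_alllt/Delta0_imp; first by do ! constructor.
apply: Delta0_bigand => q'; apply/Delta0_imp; first exact: Delta0_digit.
apply: Delta0_bigor => e; apply/Delta0_and; first exact: Delta0_digit.
by apply: Delta0_bigand => i; apply: Delta0_digit.
Qed.

Lemma sat_block (M : structure) (r : nat -> M) n t p :
  sat r (exlt_block n t p) <->
  exists w : nat -> M, (forall i, i < n -> (w i < eval r t)%M) /\
    sat (fun j => if j < n then w j else r (j - n)) p.
Proof.
elim: n r t => [|n IH] r t.
  have E w : (fun j => if j < 0 then w j else r (j - 0)) = r.
    by apply/funext => j; rewrite subn0.
  by split=> [H|[w [_]]]; [exists r|]; rewrite E.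
rewrite [exlt_block _ _ _]/= sat_exlt; split.
  move=> [a [lta /IH[w [ltw]]]]; set R := (X in sat X _) => H.
  exists (fun j => if j < n then w j else a); split=> [i|].
    rewrite ltnS leq_eqVlt => /predU1P[->|ilt]; first by rewrite ltnn.
    by rewrite ilt; move: (ltw _ ilt); rewrite eval_sh.
  suff -> : (fun j => if j < n.+1 then if j < n then w j else a
    else r (j - n.+1)) = R by [].
  apply/funext => j; rewrite /R ltnS; case: ltngtP => [//|nj|->].
    by rewrite -[j - n]/(j.+1 - n.+1) subSn //.
  by rewrite subnn.
move=> [w [ltw H]]; exists (w n); split; first exact: ltw.
apply/IH; exists w; split=> [i ilt|].
  by rewrite eval_sh; apply: ltw; apply: ltnW.
suff <- : (fun j => if j < n.+1 then w j else r (j - n.+1)) =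
  (fun j => if j < n then w j else ext (w n) r (j - n)) by [].
apply/funext => j; rewrite ltnS; case: ltngtP => [//|nj|->].
  by rewrite -[j - n]/(j.+1 - n.+1) subSn //.
by rewrite subnn.
Qed.

(** * Automata *)

(** Automata reading the digits of all variables at once.  A letter assigns a
    digit to every variable, of which only those below [n] matter: in this way
    an automaton for a formula reads letters shaped like environments. *)
Record dfa (n : nat) := Dfa {
  dst : finType;
  dinit : dst;
  dacc : {set dst};
  dstep : dst -> (nat -> nat) -> dst;
  dstepP : forall q c c', (forall i, i < n -> c i = c' i) ->
    dstep q c = dstep q c'
}.

(** A letter of the finite alphabet is zero on the tracks from [n] on. *)
Definition letter k n (a : n.-tuple 'I_k) (i : nat) : nat :=
  nth 0 (map val a) i.

Definition aut k n (A : dfa n) : automaton k n :=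
  @Automaton k n (dst A) (dinit A) (dacc A)
    [set e | e.2 == dstep e.1.1 (letter e.1.2)].

Lemma letterE k n (a : n.-tuple 'I_k) (i : 'I_n) : letter a i = tnth a i.
Proof.
have x0 := tnth a i.
by rewrite (tnth_nth x0) /letter (nth_map x0) ?size_tuple.
Qed.

Lemma aut_deterministic k n (A : dfa n) : deterministic (aut k A).
Proof.
move=> q a; exists (dstep q (letter a)); split=> [|q']; first by rewrite inE.
by rewrite inE => /eqP.
Qed.

(** ** Definable properties of powers *)

Section Definability.

Variables (k : nat) (M : structure).
Hypothesis hk : (1 < k)%N.
Hypothesis HM : models k M.
Local Open Scope model_scope.

(** The properties of powers to which induction applies.  They are closed under
    Boolean operations, which spares writing down most of the bounded formulas
    by which they are defined. *)
Definition definable (P : M -> Prop) : Prop :=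
  exists p r, Delta0 p /\ forall d, Pw d -> (sat (ext d r) p <-> P d).

Lemma definable_ind P : definable P -> P 1 ->
  (forall d, Pw d -> P d -> P (k * d)) -> forall d, Pw d -> P d.
Proof.
move=> [p [r [Dp pP]]] P1 PS d Pd; apply/pP => //.
apply: (Pw_ind hk HM Dp) Pd; first exact/(pP _ (Pw1 HM)).
move=> e Pe; rewrite pP // => /(PS _ Pe).
by rewrite pP //; apply: (Pwk hk HM).
Qed.

Lemma definable_sat p r : Delta0 p -> definable (fun d => sat (ext d r) p).
Proof. by move=> Dp; exists p, r. Qed.

Lemma definable_ext P Q : (forall d, Pw d -> (P d <-> Q d)) ->
  definable P -> definable Q.
Proof.
move=> PQ [p [r [Dp H]]]; exists p, r; split=> // d Pd.
by rewrite -PQ // H.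
Qed.

Lemma definable_const (Q : Prop) : definable (fun _ => Q).
Proof.
case: (pselect Q) => HQ; [exists fTop|exists fBot];
  exists (fun _ => s0 M); split; try by do ! constructor.
  by move=> d _; split=> // _ [].
Qed.

(** The parameters of two definitions are interleaved into one environment. *)
Lemma definable_op (op : formula -> formula -> formula)
    (opP : Prop -> Prop -> Prop) :
  (forall p q, Delta0 p -> Delta0 q -> Delta0 (op p q)) ->
  (forall (r : nat -> M) p q, sat r (op p q) <-> opP (sat r p) (sat r q)) ->
  forall P Q, definable P -> definable Q -> definable (fun d => opP (P d) (Q d)).
Proof.
move=> Dop sop P Q [p [r [Dp pP]]] [q [s [Dq qQ]]].
pose r' i := if odd i then s i./2 else r i./2.
pose f i := Var (if i is j.+1 then j.*2.+1 else 0).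
pose g i := Var (if i is j.+1 then j.*2.+2 else 0).
exists (op (fsubst f p) (fsubst g q)), r'; split.
  by apply: Dop; apply: Delta0_subst.
move=> d Pd; rewrite sop.
have -> : sat (ext d r') (fsubst f p) = P d.
  apply/propext; rewrite sat_subst -pP //.
  suff -> : (fun i => eval (ext d r') (f i)) = ext d r by [].
  by apply/funext => -[|i] //=; rewrite /r' odd_double doubleK.
suff -> : sat (ext d r') (fsubst g q) = Q d by [].
apply/propext; rewrite sat_subst -qQ //.
suff -> : (fun i => eval (ext d r') (g i)) = ext d s by [].
by apply/funext => -[|i] //=; rewrite /r' /= odd_double uphalf_double.
Qed.

Lemma definable_and P Q : definable P -> definable Q ->
  definable (fun d => P d /\ Q d).
Proof. by apply: (definable_op (op := fAnd) (opP := and)) => //; constructor. Qed.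

Lemma definable_imp P Q : definable P -> definable Q ->
  definable (fun d => P d -> Q d).
Proof.
by apply: (definable_op (op := fImp) (opP := fun P Q => P -> Q)) => //; constructor.
Qed.

Lemma definable_not P : definable P -> definable (fun d => ~ P d).
Proof. by move=> DP; apply: definable_imp (definable_const _). Qed.

Lemma definable_iff P Q : definable P -> definable Q ->
  definable (fun d => P d <-> Q d).
Proof. by move=> DP DQ; apply: definable_and; apply: definable_imp. Qed.

Lemma definable_all (I : finType) (P : I -> M -> Prop) :
  (forall i, definable (P i)) -> definable (fun d => forall i, P i d).
Proof.
move=> DP; suff : definable (fun d => forall i, i \in enum I -> P i d).
  apply: definable_ext => d _.
  by split=> H i; [apply: H; rewrite mem_enum | move=> _].
elim: (enum I) => [|i s IH].
  by apply: definable_ext (definable_const True) => d _; split.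
apply: definable_ext (definable_and (DP i) IH) => d _; split.
  by move=> [Pi Ps] j; rewrite inE => /predU1P[->//|/Ps].
by move=> H; split=> [|j js]; apply: H; rewrite inE ?eqxx // js orbT.
Qed.

Lemma definable_exists (I : finType) (P : I -> M -> Prop) :
  (forall i, definable (P i)) -> definable (fun d => exists i, P i d).
Proof.
move=> DP.
have := definable_not (definable_all (fun i => definable_not (DP i))).
apply: definable_ext => d _; split=> [H|[i Pi] /(_ i)]; last by [].
by apply: contrapT => nP; apply: H => i Pi; apply: nP; exists i.
Qed.

(** ** Runs *)

Section Runs.

Variables (n : nat) (A : dfa n).
Implicit Types (X Y : nat -> M) (q : dst A) (w : dst A -> M) (d e : M).

Definition dgs X d (i : nat) : nat := dg k (X i) d.

(** [w q] codes the set of positions at which the run is in state [q]. *)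
Definition coded_run X d q1 w : Prop :=
  [/\ forall q, w q < k * d,
      forall e, e <= d -> Pw e -> exists q, forall q', dg k (w q') e = (q' == q),
      dg k (w (dinit A)) 1 = 1%N,
      dg k (w q1) d = 1%N &
      forall e, e < d -> Pw e -> forall q, dg k (w q) e = 1%N ->
        dg k (w (dstep q (dgs X e))) (k * e) = 1%N].

Definition Run X d q : Prop := Pw d /\ exists w, coded_run X d q w.

(** In the model, the digit conditions of W are equations between digits, and
    the block of quantifiers over the codes is one quantifier over functions on
    the states. *)
Lemma sat_W (r : nat -> M) q (x : 'I_n -> term) (d : term) X :
  (forall i : 'I_n, eval r (x i) = X i) ->
  sat r (@W k n (aut k A) q x d) <-> Run X (eval r d) q.
Proof.
move=> xX; rewrite /W; set N := #|_|.
rewrite sat_and sat_block.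
pose R (w : nat -> M) := fun j => if (j < N)%N then w j else r (j - N)%N.
have RS (w : nat -> M) t : eval (R w) (shn N t) = eval r t.
  rewrite eval_shn; congr eval; apply/funext => i.
  by rewrite /R ltnNge leq_addr addKn.
have RSS (w : nat -> M) e t : eval (ext e (R w)) (shn N.+1 t) = eval r t.
  by rewrite -(RS w t) !eval_shn.
have Rw (w : nat -> M) (q' : dst A) :
    eval (R w) (Var (enum_rank q')) = w (enum_rank q').
  by rewrite /= /R ltn_ord.
have k0 := k_gt0 hk.
have dg1 y e : Pw e -> (Dig y e 1 <-> dg k y e = 1%N).
  by move=> Pe; rewrite (Dig_dg hk HM) //; split=> // -[].
have dg0 y e : Pw e -> (Dig y e 0 <-> dg k y e = 0%N).
  by move=> Pe; rewrite (Dig_dg hk HM) //; split=> // -[].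
split=> -[Pd [w H]]; split=> //.
  exists (fun q' => w (enum_rank q')).
  case: H => ltw /sat_and[H1 /sat_and[H2 /sat_and[H3 H4]]]; split.
  - by move=> q'; move: (ltw _ (ltn_ord (enum_rank q'))); rewrite eval_tmul.
  - move=> e; rewrite -(RS w d) => ed Pe.
    move/sat_allle: H1 => /(_ _ ed)/sat_imp/(_ Pe)/sat_bigorP[q' [_ _]].
    move/sat_and=> [/(sat_digit HM)]; rewrite eval_sh Rw => /(dg1 _ _ Pe) D1.
    move/sat_bigandP=> H0; exists q' => q''.
    case: eqP => [->//|/eqP nq]; move: (H0 q'' (mem_index_enum _) nq).
    by move/(sat_digit HM); rewrite eval_sh Rw => /(dg0 _ _ Pe).
  - move/(sat_digit HM): H2; rewrite Rw; apply: (dg1 _ _ _).1; exact: (Pw1 HM).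
  - by move/(sat_digit HM): H3; rewrite Rw RS => /(dg1 _ _ Pd).
  - move=> e; rewrite -{1}(RS w d) => ed Pe q' D.
    move/sat_alllt: H4 => /(_ _ ed)/sat_imp/(_ Pe)/sat_bigandP.
    move=> /(_ q' (mem_index_enum _) isT)/sat_imp H4.
    have /H4 : sat (ext e (R w)) (digit (sh (Var (enum_rank q'))) (Var 0) 1).
      by apply/(sat_digit HM); rewrite eval_sh Rw; apply/dg1.
    case/sat_bigorP => -[[q0 a] q1] [_ tr HS]; move: tr HS.
    rewrite [_ && _]/= inE [X in X -> _]/= => /andP[/eqP -> /eqP ->].
    move=> /sat_and[/(sat_digit HM)]; rewrite eval_sh Rw eval_tmul.
    move=> /(dg1 _ _ (Pwk hk HM Pe)) /= Dq /sat_bigandP Da; rewrite -Dq.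
    congr (dg k (w (enum_rank _))); apply: dstepP => i ilt.
    move: (Da (Ordinal ilt) (mem_index_enum _) isT) => /(sat_digit HM).
    rewrite RSS xX (Dig_dg hk HM); last exact: ltn_ord.
    by case=> _ /= Di; rewrite /dgs Di -(letterE a (Ordinal ilt)).
case: H => ltw H1 H2 H3 H4.
pose w' j := if insub j is Some o then w (enum_val (o : 'I_N)) else s0 M.
have w'E q' : w' (enum_rank q') = w q'.
  by rewrite /w' valK enum_rankK.
exists w'; split=> [i ilt|].
  by rewrite eval_tmul /w' insubT.
apply/sat_and; split.
  apply/sat_allle => e; rewrite RS => ed; apply/sat_imp => Pe.
  case: (H1 e ed Pe) => q' Dq; apply/sat_bigorP; exists q'; split=> //.
  apply/sat_and; split.
    by apply/(sat_digit HM); rewrite eval_sh Rw w'E; apply/dg1; rewrite // Dq eqxx.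
  apply/sat_bigandP => q'' _ nq; apply/(sat_digit HM); rewrite eval_sh Rw w'E.
  by apply/dg0; rewrite // Dq (negbTE nq).
apply/sat_and; split.
  by apply/(sat_digit HM); rewrite Rw w'E; apply/dg1 => //; apply: (Pw1 HM).
apply/sat_and; split.
  by apply/(sat_digit HM); rewrite Rw w'E RS; apply/dg1.
apply/sat_alllt => e; rewrite RS => ed; apply/sat_imp => Pe.
apply/sat_bigandP => q' _ _; apply/sat_imp => /(sat_digit HM).
rewrite eval_sh Rw w'E => /(dg1 _ _ Pe) Dq; apply/sat_bigorP.
pose a := [tuple Ordinal (dg_lt hk HM (X i) Pe) | i < n].
exists (q', a, dstep q' (letter a)); split=> //.
  by rewrite inE /= !eqxx.
apply/sat_and; split.
  apply/(sat_digit HM); rewrite eval_sh Rw w'E eval_tmul; apply/dg1.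
    exact: (Pwk hk HM).
  rewrite -(H4 e ed Pe q' Dq) /=; congr (dg k (w _)); apply: dstepP => i ilt.
  by rewrite -[i]/(val (Ordinal ilt)) letterE tnth_mktuple.
apply/sat_bigandP => i _ _; apply/(sat_digit HM); rewrite RSS xX /=.
by apply/(Dig_dg hk HM); rewrite ?ltn_ord // tnth_mktuple.
Qed.

Lemma Run_1 X q : Run X 1 q <-> q = dinit A.
Proof.
have P1 := Pw1 HM; have k0 := k_gt0 hk.
split=> [[_ [w [_ H1 H2 H3 _]]]|->].
  case: (H1 1 (le_refl HM 1) P1) => q0 E.
  move: (E q); rewrite H3; case: eqP => // -> _.
  by move: (E (dinit A)); rewrite H2; case: eqP => // ->.
split=> //; exists (fun q' => mul (q' == dinit A) 1).
have dE e q' : e <= 1 -> Pw e -> dg k (mul (q' == dinit A) 1) e = (q' == dinit A).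
  move=> e1 Pe; have -> : e = 1 by apply: (le_anti HM) => //; apply: (Pw_ge1 HM).
  rewrite -[mul _ _](add0x HM); apply: (dg_extend hk HM) => //.
    exact: (lt01 HM).
  by case: eqP => _ //.
split.
- by move=> q'; apply: (mul_ltl HM); [case: eqP => _ // | exact: (lt01 HM)].
- by move=> e e1 Pe; exists (dinit A) => q'; apply: dE.
- by rewrite dE ?eqxx //; apply: (le_refl HM).
- by rewrite dE ?eqxx //; apply: (le_refl HM).
- by move=> e e1 Pe; case: (lt_not_le HM e1 (Pw_ge1 HM Pe)).
Qed.

(** A run is shortened by reducing its codes modulo [k * d] and prolonged by
    adding [k * d] to the code of the next state. *)
Lemma Run_k X d q : Pw d ->
  Run X (k * d) q <-> exists2 q0, Run X d q0 & q = dstep q0 (dgs X d).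
Proof.
move=> Pd; have Pkd := Pwk hk HM Pd; have k0 := k_gt0 hk.
have dkd : d < k * d by apply: (lt_kd hk HM); case: Pd.
split=> [[_ [w [H0 H1 H2 H3 H4]]]|[q0 [_ [w [H0 H1 H2 H3 H4]]] ->]].
  case: (H1 d (ltW dkd) Pd) => q0 E0.
  have Dq0 : dg k (w q0) d = 1%N by rewrite E0 eqxx.
  exists q0; last first.
    case: (H1 _ (le_refl HM _) Pkd) => q1 E1.
    move: (E1 q); rewrite H3; case: eqP => // -> _.
    by move: (E1 (dstep q0 (dgs X d))); rewrite H4 //; case: eqP => // ->.
  split=> //; exists (fun q' => lo (w q') (k * d)).
  have dE e q' : e <= d -> Pw e -> dg k (lo (w q') (k * d)) e = dg k (w q') e.
    by move=> ed Pe; apply: (dg_lo hk HM) => //; apply: (le_lt_trans HM) dkd.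
  split.
  - by move=> q'; apply: (lo_lt hk HM).
  - move=> e ed Pe; case: (H1 e _ Pe) => [|q' Eq].
      by apply: (le_trans HM) ed _; apply: ltW.
    by exists q' => q''; rewrite dE.
  - by rewrite dE //; [exact: (Pw_ge1 HM) | exact: (Pw1 HM)].
  - by rewrite dE //; apply: (le_refl HM).
  - move=> e ed Pe q'; rewrite dE //; last exact: ltW.
    move=> Dq; rewrite dE //; [|exact: (Pw_gap HM)|exact: (Pwk hk HM)].
    by apply: H4 => //; apply: (lt_le_trans HM) ed _; apply: ltW.
split=> //; set q1 := dstep _ _.
exists (fun q' => w q' + mul (q' == q1) (k * d)).
have b1 (b : bool) : (b < k)%N by case: b.
have loE q' : lo (w q' + mul (q' == q1) (k * d)) (k * d) = w q'.
  by apply: (lo_extend HM).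
have dE e q' : e <= d -> Pw e ->
    dg k (w q' + mul (q' == q1) (k * d)) e = dg k (w q') e.
  move=> ed Pe; rewrite -[in RHS]loE (dg_lo hk HM) //.
  exact: (le_lt_trans HM) dkd.
have dEk q' : dg k (w q' + mul (q' == q1) (k * d)) (k * d) = (q' == q1).
  by apply: (dg_extend hk HM).
split.
- by move=> q'; apply: (add_mul_lt HM).
- move=> e ekd Pe; case: (Pw_le_k HM Pd Pe ekd) => [ed|->].
    by case: (H1 e ed Pe) => q' Eq; exists q' => q''; rewrite dE.
  by exists q1.
- by rewrite dE //; [exact: (Pw_ge1 HM) | exact: (Pw1 HM)].
- by rewrite dEk eqxx.
- move=> e ekd Pe q'; have ed := Pw_lt_k HM Pd Pe ekd.
  rewrite dE // => Dq.
  case: (pselect (e = d)) => [e_d|ned].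
    move: Dq; rewrite e_d => Dq; rewrite dEk.
    suff -> : q' = q0 by rewrite eqxx.
    case: (H1 d (le_refl HM d) Pd) => q2 E2.
    move: (E2 q'); rewrite Dq; case: eqP => // -> _.
    by move: (E2 q0); rewrite H3; case: eqP => // ->.
  have ltd : e < d by split.
  by rewrite dE //; [exact: H4 | exact: (Pw_gap HM) | exact: (Pwk hk HM)].
Qed.

Lemma definable_Run X q : definable (fun d => Run X d q).
Proof.
have := definable_sat X (@Delta0_W k n (aut k A) q (fun i => Var i.+1) (Var 0)).
by apply: definable_ext => d Pd; apply: sat_W.
Qed.

Lemma Run_unique X d : Pw d -> exists q, forall q', Run X d q' <-> q' = q.
Proof.
apply: (@definable_ind (fun d => exists q, forall q', Run X d q' <-> q' = q)).
- apply: definable_exists => q; apply: definable_all => q'.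
  by apply: definable_iff (definable_Run _ _) (definable_const _).
- by exists (dinit A) => q'; apply: Run_1.
- move=> e Pe [q0 E]; exists (dstep q0 (dgs X e)) => q'; rewrite Run_k //.
  by split=> [[q1 /E ->]|->] //; exists q0 => //; apply/E.
Qed.

(** The state reached after the digits of [X] at the positions below [d]. *)
Definition st X d : dst A := pickp (dinit A) (Run X d).

Lemma stP X d q : Pw d -> Run X d q <-> st X d = q.
Proof.
move=> Pd; case: (Run_unique X Pd) => q0 E.
have /E sE : Run X d (st X d) by apply: pickpP; exists q0; apply/E.
by rewrite E sE; split=> ->.
Qed.

Lemma st_1 X : st X 1 = dinit A.
Proof. by apply/(stP _ _ (Pw1 HM))/Run_1. Qed.

Lemma st_k X d : Pw d -> st X (k * d) = dstep (st X d) (dgs X d).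
Proof.
move=> Pd; apply/stP; first exact: (Pwk hk HM).
by apply/Run_k => //; exists (st X d) => //; apply/stP.
Qed.

Lemma definable_st X q : definable (fun d => st X d = q).
Proof. by apply: definable_ext (definable_Run X q) => d Pd; apply: stP. Qed.

Lemma st_lo X Y d : Pw d -> (forall i, (i < n)%N -> lo (X i) d = lo (Y i) d) ->
  st X d = st Y d.
Proof.
move=> Pd XY; apply/stP => //.
have [_ [w [H0 H1 H2 H3 H4]]] : Run Y d (st Y d) by apply/stP.
split=> //; exists w; split=> // e ed Pe q Dq; rewrite -(H4 e ed Pe q Dq).
congr (dg k (w _)); apply: dstepP => i ilt; rewrite /dgs.
by rewrite -(dg_lo hk HM (X i) Pe Pd ed) -(dg_lo hk HM (Y i) Pe Pd ed) XY.
Qed.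

End Runs.

(** Bounded conditions on the remainders of three numbers are definable, since
    the remainders are bounded by the numbers. *)
Lemma definable_lo (p : formula) (x y z : M) (s : nat -> M) : Delta0 p ->
  definable (fun d => sat (ext (lo x d) (ext (lo y d) (ext (lo z d) (ext d s)))) p).
Proof.
move=> Dp.
pose f := exle (Var 1) (exle (Var 3) (exle (Var 5)
  (fAnd (fLo (Var 4) (Var 3) (Var 2)) (fAnd (fLo (Var 5) (Var 3) (Var 1))
    (fAnd (fLo (Var 6) (Var 3) (Var 0)) (fsubst (ext (Var 2) (ext (Var 1)
      (ext (Var 0) (ext (Var 3) (fun i => Var i.+4.+3))))) p)))))).
pose r := ext x (ext y (ext z s)).
have Df : Delta0 f.
  do 3! apply: Delta0_exle.
  by do 3! (apply: Delta0_and; first exact: Delta0_fLo); apply: Delta0_subst.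
apply: definable_ext (definable_sat r Df) => d Pd; rewrite /f.
have envE a b c :
  (fun i => eval (ext c (ext b (ext a (ext d r)))) (ext (Var 2) (ext (Var 1)
      (ext (Var 0) (ext (Var 3) (fun i => Var i.+4.+3)))) i)) =
  ext a (ext b (ext c (ext d s))).
  by apply/funext => -[|[|[|[|i]]]].
split.
  move=> /sat_exle[a [_ /sat_exle[b [_ /sat_exle[c [_]]]]]].
  move=> /sat_and[/(sat_fLo HM)/(lo_uniq HM) Ea].
  move=> /sat_and[/(sat_fLo HM)/(lo_uniq HM) Eb].
  move=> /sat_and[/(sat_fLo HM)/(lo_uniq HM) Ec].
  by move: Ea Eb Ec => /= -> -> ->; rewrite sat_subst envE.
move=> H; apply/sat_exle; exists (lo x d); split; first exact: (lo_le hk HM).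
apply/sat_exle; exists (lo y d); split; first exact: (lo_le hk HM).
apply/sat_exle; exists (lo z d); split; first exact: (lo_le hk HM).
do 3! (apply/sat_and; split; first by apply/(sat_fLo HM)/(loP hk HM)).
by rewrite sat_subst envE.
Qed.

End Definability.

(** * Recognizable formulas *)

Section Recognizable.

Variable k : nat.
Hypothesis hk : 1 < k.

(** Any power exceeding all inputs may serve as the end of the run, so that
    leading zeros do not affect acceptance. *)
Definition recognizes n (A : dfa n) (p : formula) : Prop :=
  forall M : structure, models k M -> forall (r : nat -> M) (d : M), Pw d ->
    (forall i, i < n -> lt (r i) d) -> (sat r p <-> st k A r d \in dacc A).

Definition recog n p : Prop := exists A : dfa n, recognizes A p.

Lemma recog_equiv n p q :
  (forall M : structure, models k M -> forall r : nat -> M,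
     sat r p <-> sat r q) -> recog n p -> recog n q.
Proof.
move=> pq [A Ap]; exists A => M HM r d Pd rd.
by rewrite -pq // (Ap M HM r d Pd rd).
Qed.

Section Product.
Variables (n : nat) (A B : dfa n) (b : bool -> bool -> bool).

Lemma prod_stepP (q : dst A * dst B) c c' : (forall i, i < n -> c i = c' i) ->
  (dstep q.1 c, dstep q.2 c) = (dstep q.1 c', dstep q.2 c').
Proof. by move=> cc'; rewrite (dstepP q.1 cc') (dstepP q.2 cc'). Qed.

Definition prod_dfa : dfa n := {|
  dst := (dst A * dst B)%type; dinit := (dinit A, dinit B);
  dacc := [set q | b (q.1 \in dacc A) (q.2 \in dacc B)];
  dstep q c := (dstep q.1 c, dstep q.2 c); dstepP := prod_stepP |}.

Lemma st_prod (M : structure) (HM : models k M) (r : nat -> M) d : Pw d ->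
  st k prod_dfa r d = (st k A r d, st k B r d).
Proof.
apply: (definable_ind hk HM
  (P := fun d => st k prod_dfa r d = (st k A r d, st k B r d))).
- suff : definable (fun d => forall q : dst prod_dfa,
      st k prod_dfa r d = q <-> (st k A r d = q.1 /\ st k B r d = q.2)).
    apply: definable_ext => e _; split=> [H|-> [q1 q2]].
      by have [/(_ erefl)[-> ->] _] := H (st k prod_dfa r e); case: (st _ _ _ _).
    by split=> [[-> ->]|[/= -> ->]].
  apply: definable_all => q; apply: definable_iff.
    exact: (definable_st hk HM).
  by apply: definable_and; apply: (definable_st hk HM).
- by rewrite !(st_1 hk HM).
- by move=> e Pe; rewrite !(st_k hk HM) // => ->.
Qed.
End Product.

Lemma recog_op n (op : formula -> formula -> formula) (b : bool -> bool -> bool) :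
  (forall (M : structure) (r : nat -> M) p q,
     sat r (op p q) <-> b `[< sat r p >] `[< sat r q >]) ->
  forall p q, recog n p -> recog n q -> recog n (op p q).
Proof.
move=> opb p q [A Ap] [B Bq]; exists (prod_dfa A B b) => M HM r d Pd rd.
rewrite opb st_prod // inE /=.
have -> : `[< sat r p >] = (st k A r d \in dacc A).
  by apply/asboolP/idP => /(Ap M HM r d Pd rd).
have -> // : `[< sat r q >] = (st k B r d \in dacc B).
by apply/asboolP/idP => /(Bq M HM r d Pd rd).
Qed.

Lemma recog_and n p q : recog n p -> recog n q -> recog n (fAnd p q).
Proof.
apply: (recog_op (b := andb)) => M r p' q'.
by split=> [[] /asboolP -> /asboolP ->|/andP[/asboolP ? /asboolP]].
Qed.

Lemma recog_or n p q : recog n p -> recog n q -> recog n (fOr p q).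
Proof.
apply: (recog_op (b := orb)) => M r p' q'; split.
  by case=> /asboolP ->; rewrite ?orbT.
by case/orP=> /asboolP; [left|right].
Qed.

Lemma recog_imp n p q : recog n p -> recog n q -> recog n (fImp p q).
Proof.
apply: (recog_op (b := implb)) => M r p' q'; split.
  by move=> H; apply/implyP => /asboolP /H /asboolP.
by move/implyP => H /asboolP /H /asboolP.
Qed.

Lemma recog_bot n : recog n fBot.
Proof.
exists (@Dfa n unit tt set0 (fun q _ => q) (fun _ _ _ _ => erefl)).
by move=> M HM r d Pd rd; rewrite inE.
Qed.

Lemma recog_not n p : recog n p -> recog n (fNot p).
Proof. by move=> Rp; apply: recog_imp Rp (recog_bot n). Qed.

Section Renaming.
Variables (n m : nat) (A : dfa n) (f : nat -> nat).
Hypothesis fm : forall i, i < n -> f i < m.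

Lemma ren_stepP (q : dst A) (c c' : nat -> nat) :
  (forall i, i < m -> c i = c' i) -> dstep q (c \o f) = dstep q (c' \o f).
Proof. by move=> cc'; apply: dstepP => i /fm /cc'. Qed.

Definition ren_dfa : dfa m := {|
  dst := dst A; dinit := dinit A; dacc := dacc A;
  dstep q c := dstep q (c \o f); dstepP := ren_stepP |}.

Lemma st_ren (M : structure) (HM : models k M) (r : nat -> M) d : Pw d ->
  st k ren_dfa r d = st k A (r \o f) d.
Proof.
apply: (definable_ind hk HM
  (P := fun d => st k ren_dfa r d = st k A (r \o f) d)).
- suff : definable (fun d => forall q : dst A,
      st k ren_dfa r d = q <-> st k A (r \o f) d = q).
    apply: definable_ext => e _; split=> [H|-> //].
    by have [_ ->] := H (st k A (r \o f) e).
  apply: definable_all => q; apply: definable_iff.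
    exact: (definable_st hk HM).
  exact: (definable_st hk HM).
- by rewrite !(st_1 hk HM).
- by move=> e Pe; rewrite !(st_k hk HM) // => ->.
Qed.
End Renaming.

Lemma recog_ren n m f p : (forall i, i < n -> f i < m) ->
  recog n p -> recog m (fsubst (fun i => Var (f i)) p).
Proof.
move=> fm [A Ap]; exists (ren_dfa A fm) => M HM r d Pd rd.
rewrite st_ren // sat_subst; apply: (Ap M HM (r \o f) d Pd) => i /fm.
exact: rd.
Qed.

(** ** Projection *)

Section Projection.
Variables (n : nat) (A : dfa n.+1).

(** One step of the subset automaton, which guesses the digit of the projected
    track. *)
Definition sub_step (S : {set dst A}) (c : nat -> nat) : {set dst A} :=
  [set q | [exists q0 in S, [exists a : 'I_k, q == dstep q0 (ext (a : nat) c)]]].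

Lemma sub_stepP S c c' : (forall i, i < n -> c i = c' i) ->
  sub_step S c = sub_step S c'.
Proof.
move=> cc'; apply/setP => q; rewrite !inE.
apply: eq_existsb => q0; congr andb; apply: eq_existsb => a.
by congr (_ == _); apply: dstepP => -[|i] //=; rewrite ltnS => /cc'.
Qed.

Definition zero_step : rel (dst A) :=
  fun q q' => [exists a : 'I_k, q' == dstep q (ext (a : nat) (fun _ => 0))].

(** The projected input may be longer than the others, hence a set of states
    is accepting if acceptance is reachable while the others read zeros. *)
Definition sub_dfa : dfa n := {|
  dst := {set dst A}; dinit := [set dinit A];
  dacc := [set S : {set dst A} |
             [exists q in S, [exists q' in dacc A, connect zero_step q q']]];
  dstep := sub_step; dstepP := sub_stepP |}.

Variables (M : structure) (HM : models k M) (r : nat -> M).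

Lemma dgs_ext (x d : M) : dgs k (ext x r) d = ext (dg k x d) (dgs k r d).
Proof. by apply/funext => -[|i]. Qed.

(** In the step from [e] to [k * e], the guessed digit [a] prolongs the witness
    [x] to [x + a * e]; conversely a witness is truncated. *)
Lemma st_sub d : Pw d -> forall q,
  q \in (st k sub_dfa r d : {set dst A}) <->
  exists x, lt x d /\ st k A (ext x r) d = q.
Proof.
apply: (definable_ind hk HM (P := fun d => forall q,
  q \in (st k sub_dfa r d : {set dst A}) <->
  exists x, lt x d /\ st k A (ext x r) d = q)).
- apply: definable_all => q; apply: definable_iff.
    have : definable (fun d => exists S : {set dst A}, q \in S /\
        st k sub_dfa r d = S).
      apply: definable_exists => S.
      apply: definable_and; first exact: definable_const.
      exact: (definable_st hk HM).
    apply: definable_ext => e _; split=> [[S [qS ->]] //|qS].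
    by exists (st k sub_dfa r e).
  pose v (i : 'I_n.+1) := Var (if i == 0 :> nat then 0 else i.+1).
  have := definable_sat r (Delta0_exlt (Var 0)
    (@Delta0_W k n.+1 (aut k A) q v (Var 1))).
  apply: definable_ext => e Pe; rewrite sat_exlt.
  have WE x : sat (ext x (ext e r)) (@W k n.+1 (aut k A) q v (Var 1)) <->
      st k A (ext x r) e = q.
    rewrite -(stP hk HM) //; apply: (sat_W hk HM) => i.
    by rewrite /v; case: i => -[|i] ilt.
  by split=> -[x [xd /WE H]]; exists x.
- move=> q; rewrite (st_1 hk HM) inE; split=> [/eqP ->|].
    by exists (s0 M); split; [exact: lt01 HM | exact: st_1].
  by case=> x [_]; rewrite (st_1 hk HM) => ->.
- move=> e Pe IH q; rewrite (st_k hk HM) //= inE; split.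
    case/existsP => q0 /andP[/IH[x [xd <-]] /existsP[a /eqP ->]].
    exists (sP x (mul a e)); split; first exact: (add_mul_lt HM).
    rewrite (st_k hk HM) // dgs_ext (dg_extend hk HM) //.
    congr dstep; apply: (st_lo hk HM) => // -[|i] _ //=.
    by rewrite (lo_extend HM) // (lo_small HM).
  case=> x [xkd]; rewrite (st_k hk HM) // dgs_ext => <-.
  apply/existsP; exists (st k A (ext x r) e); apply/andP; split.
    apply/IH; exists (lo x e); split; first exact: (lo_lt hk HM).
    apply: (st_lo hk HM) => // -[|i] _ //=.
    by rewrite (lo_lo hk HM) //; apply: (le_refl HM).
  by apply/existsP; exists (Ordinal (dg_lt hk HM x Pe)).
Qed.

Variable d : M.
Hypotheses (Pd : Pw d) (rd : forall i, i < n -> lt (r i) d).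

Lemma zero_dgs x e : Pw e -> sle d e ->
  forall q : dst A, dstep q (dgs k (ext x r) e) =
    dstep q (ext (dg k x e) (fun _ => 0)).
Proof.
move=> Pe de q; apply: dstepP => -[|i] //; rewrite ltnS => /rd ilt /=.
by apply: (dg_small hk HM) => //; apply: (lt_le_trans HM) de.
Qed.

(** Although [e] may be nonstandardly far beyond [d], the states passed between
    are connected in finitely many steps: being connected to the state at [d] is
    a property of a state in a finite set, hence definable, and each step
    preserves it. *)
Lemma connect_st x e : Pw e -> sle d e ->
  connect zero_step (st k A (ext x r) d) (st k A (ext x r) e).
Proof.
move=> Pe; move: e Pe; set q := st _ _ _ _.
apply: (definable_ind hk HM (P := fun e => sle d e ->
  connect zero_step q (st k A (ext x r) e))).
- apply: definable_imp.
    have D : Delta0 (Var 1 <= Var 0)%fo by constructor.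
    exact: definable_ext (definable_sat (fun _ => d) D).
  have : definable (fun e => exists q', connect zero_step q q' /\
      st k A (ext x r) e = q').
    apply: definable_exists => q'.
    apply: definable_and; first exact: definable_const.
    exact: (definable_st hk HM).
  apply: definable_ext => e _; split=> [[q' [qq' ->]] //|qq'].
  by exists (st k A (ext x r) e).
- move=> d1; suff E : d = one by rewrite /q E.
  by apply: (le_anti HM) => //; apply: (Pw_ge1 HM).
- move=> e Pe IH de; case: (le_or_lt HM d e) => [d_e|ed].
    apply: connect_trans (IH d_e) (connect1 _); rewrite (st_k hk HM) //.
    rewrite zero_dgs //.
    by apply/existsP; exists (Ordinal (dg_lt hk HM x Pe)).
  have E : d = mul k e by apply: (le_anti HM) => //; apply: (Pw_gap HM).
  by rewrite /q E.
Qed.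

(** The finitely many steps of a connecting path prolong [x] by finitely many
    digits. *)
Lemma st_connect q x : lt x d -> connect zero_step (st k A (ext x r) d) q ->
  exists x' e, [/\ Pw e, sle d e, lt x' e & st k A (ext x' r) e = q].
Proof.
move=> xd /connectP[s]; set q0 := st _ _ _ _.
have : exists x' e, [/\ Pw e, sle d e, lt x' e & st k A (ext x' r) e = q0].
  by exists x, d; split=> //; apply: (le_refl HM).
elim: s (q0) => [|q2 s IH] q1 H /=; first by move=> _ ->.
case/andP=> /existsP[a /eqP E] ps ql; apply: IH ps ql.
case: H => x1 [e [Pe de xe E1]].
have ke : sle e (mul k e) by apply: (mul_ge HM); apply: k_gt0.
exists (sP x1 (mul a e)), (mul k e); split.
- exact: (Pwk hk HM).
- exact: (le_trans HM) ke.
- exact: (add_mul_lt HM).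
rewrite (st_k hk HM) // zero_dgs // (dg_extend hk HM) // E -E1.
congr dstep; apply: (st_lo hk HM) => // -[|i] _ //=.
by rewrite (lo_extend HM) // (lo_small HM).
Qed.

End Projection.

Lemma Pw_above (M : structure) (HM : models k M) (x d : M) : Pw d ->
  exists e, [/\ Pw e, sle d e & lt x e].
Proof.
move=> Pd; case: (le_or_lt HM d x) => [dx|xd]; last first.
  by exists d; split=> //; apply: (le_refl HM).
have x0 : lt (s0 M) x by apply: (lt_le_trans HM) dx; case: Pd.
case: (V4_ex HM x0) => e [Pe _ xe]; exists (mul k e); split=> //.
  exact: (Pwk hk HM).
by apply: (le_trans HM) dx _; apply: ltW.
Qed.

Lemma recog_ex n p : recog n.+1 p -> recog n (fEx p).
Proof.
move=> [A Ap]; exists (sub_dfa A) => M HM r d Pd rd; rewrite inE.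
split=> [[x px]|].
  case: (Pw_above HM x Pd) => e [Pe de xe].
  apply/existsP; exists (st k A (ext x r) d); apply/andP; split.
    apply/(st_sub HM) => //; exists (lo x d); split; first exact: (lo_lt hk HM).
    apply: (st_lo hk HM) => // -[|i] _ //=.
    by rewrite (lo_lo hk HM) //; apply: (le_refl HM).
  apply/existsP; exists (st k A (ext x r) e); apply/andP; split.
    apply/(Ap M HM _ e) => // -[|i] //=; rewrite ltnS => /rd ri.
    exact: (lt_le_trans HM) de.
  by apply: (connect_st A HM Pd rd).
case/existsP => q /andP[/(st_sub HM _ Pd)[x [xd <-]]].
case/existsP => q' /andP[q'A /(st_connect HM Pd rd xd)[x' [e [Pe de xe E]]]].
exists x'; apply/(Ap M HM _ e) => //; last by rewrite E.
by case=> [|i] //=; rewrite ltnS => /rd ri; apply: (lt_le_trans HM) de.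
Qed.

Lemma recog_all n p : recog n.+1 p -> recog n (fAll p).
Proof.
move=> Rp; have := recog_not (recog_ex (recog_not Rp)).
apply: recog_equiv => M HM r; split=> [H a|H [a]]; last by apply; apply: H.
by apply: contrapT => np; apply: H; exists a.
Qed.

(** ** Addition and valuation *)

(** The states of the adder: the carry, or [None] once the sum has failed. *)
Definition add_step (q : option bool) (c : nat -> nat) : option bool :=
  if q is Some b then
    if b + c 0 + c 1 == c 2 then Some false
    else if b + c 0 + c 1 == c 2 + k then Some true else None
  else None.

Lemma add_stepP q c c' : (forall i, i < 3 -> c i = c' i) ->
  add_step q c = add_step q c'.
Proof. by move=> cc'; rewrite /add_step !cc'. Qed.

Definition add_dfa : dfa 3 := {|
  dst := option bool; dinit := Some false; dacc := [set Some false];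
  dstep := add_step; dstepP := add_stepP |}.

Lemma add_step_carry (b c : bool) l :
  add_step (Some b) l = Some c <-> b + l 0 + l 1 = l 2 + c * k.
Proof.
have k0 : 0 < k by apply: ltnW.
rewrite /add_step; case: eqP => [->|nE]; last case: eqP => [->|nE'].
- case: c; rewrite ?mul1n ?addn0; split=> // /eqP.
  by rewrite -{1}[l 2]addn0 eqn_add2l eq_sym -leqn0 leqNgt k0.
- case: c; rewrite ?mul1n ?addn0; split=> // /eqP.
  by rewrite -{2}[l 2]addn0 eqn_add2l -leqn0 leqNgt k0.
- by case: c; rewrite ?mul1n ?addn0; split.
Qed.

(** The carry into position [d] is determined by the remainders modulo [d].
    Failure persists: if the sum of the two remainders exceeds the third one by
    neither [0] nor [d], then the same holds at [k * d], as one sees by comparing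
    the coefficients of [d]. *)
Lemma st_add (M : structure) (HM : models k M) (r : nat -> M) :
  forall d, Pw d -> forall c : bool, st k add_dfa r d = Some c <->
    sP (lo (r 0) d) (lo (r 1) d) = sP (lo (r 2) d) (mul c d).
Proof.
apply: (definable_ind hk HM).
- apply: definable_all => c; apply: definable_iff.
    exact: (definable_st hk HM).
  have D : Delta0 (Var 0 + Var 1 = Var 2 + c * Var 3)%fo by constructor.
  have := definable_lo hk HM (r 0) (r 1) (r 2) r D.
  by apply: definable_ext => d _ /=; rewrite eval_tmul.
- move=> c; rewrite (st_1 hk HM) !(lo1 hk HM) !(add0x HM).
  split=> [[<-]//|]; case: c => //; rewrite (mul1 HM) => E.
  by case: (lt01 HM) => _ [].
move=> d Pd IH c; rewrite (st_k hk HM) // !(lo_k hk HM) //.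
set x := lo (r 0) d in IH *; set y := lo (r 1) d in IH *.
set z := lo (r 2) d in IH *.
have xd : lt x d by apply: (lo_lt hk HM).
have yd : lt y d by apply: (lo_lt hk HM).
have zd : lt z d by apply: (lo_lt hk HM).
have d0 : lt (s0 M) d by case: Pd.
set u := dgs k r d; rewrite -[dg k (r 0) d]/(u 0) -[dg k (r 1) d]/(u 1).
rewrite -[dg k (r 2) d]/(u 2).
have -> : sP (sP x (mul (u 0) d)) (sP y (mul (u 1) d)) =
    sP (sP x y) (mul (u 0 + u 1) d).
  by rewrite (mulnDl HM); abel_with (abelP HM).
have -> : sP (sP z (mul (u 2) d)) (mul c (mul k d)) =
    sP z (mul (u 2 + c * k) d).
  by rewrite (mulnDl HM) (mulnM HM) (addA HM).
case stE : (st k add_dfa r d) => [b|].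
  rewrite [dstep _ _]/(add_step (Some b) u) add_step_carry.
  have /IH -> : st k add_dfa r d = Some b by [].
  rewrite -(addA HM) -(mulnDl HM) addnA; split=> [-> //|].
  exact: (digit_eq HM).
split=> // E; exfalso.
have {}IH t : t < 2 -> sP x y <> sP z (mul t d).
  by case: t => [|[|//]] _ Et; [have [_] := IH false|have [_] := IH true];
    rewrite stE => /(_ Et).
case: (leqP (u 0 + u 1) (u 2 + c * k)) => [/subnKC|] H.
  move: (_ - _) H E => t <-; rewrite (mulnDl HM (u 0 + u 1)) => E.
  have {}E : sP x y = sP z (mul t d).
    by apply: (addI HM (z := mul (u 0 + u 1) d)); rewrite E;
      abel_with (abelP HM).
  case: (ltnP t 2) => t2; first exact: IH E.
  have := ltD HM xd (ltW yd); rewrite E => /(lt_not_le HM); apply.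
  apply: (le_trans HM (y := mul 2 d)).
    by rewrite mulS (mul1 HM); apply: (le_refl HM).
  apply: (le_trans HM (mul_lel HM d t2)).
  by rewrite (addC HM); apply: (le_addx HM).
move: (u 2 + c * k) H E => m /subnKC <-; move: (_ - _) => t.
rewrite addSnnS (mulnDl HM m) mulS => E.
apply: (absurd_by HM (u := sP (sP x y) (mul t d)) zd).
apply: (addI HM (z := mul m d)); rewrite -E; abel_with (abelP HM).
Qed.

Lemma recog_add : recog 3 (Var 0 + Var 1 = Var 2)%fo.
Proof.
exists add_dfa => M HM r d Pd rd; rewrite inE /=.
split=> [E|/eqP /(st_add HM r Pd)].
  by apply/eqP/(st_add HM) => //; rewrite !(lo_small HM) ?(addx0 HM) //; apply: rd.
by rewrite !(lo_small HM) ?(addx0 HM) //; apply: rd.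
Qed.

(** The states of the automaton for the valuation: [Some false] as long as all
    digits are zero, [Some true] after the first nonzero digit of the first
    track has been matched, and [None] after a failure. *)
Definition val_step (q : option bool) (c : nat -> nat) : option bool :=
  match q with
  | Some false =>
    if c 0 == 0 then (if c 1 == 0 then Some false else None)
    else if c 1 == 1 then Some true else None
  | Some true => if c 1 == 0 then Some true else None
  | None => None
  end.

Lemma val_stepP q c c' : (forall i, i < 2 -> c i = c' i) ->
  val_step q c = val_step q c'.
Proof. by move=> cc'; rewrite /val_step !cc'. Qed.

Definition val_dfa : dfa 2 := {|
  dst := option bool; dinit := Some false; dacc := [set Some false; Some true];
  dstep := val_step; dstepP := val_stepP |}.

(** What the state [Some b] says about the remainders [x] and [y] of the two
    tracks. *)
Definition val_inv (M : structure) (x y : M) (b : bool) : Prop :=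
  if b then lt (s0 M) x /\ sV x = y else x = s0 M /\ y = s0 M.

(** Once [x] is positive a further digit [a] leaves [V x] below [d], so [y] must
    receive the digit zero; the first nonzero digit [a] of the first track makes
    [V x = d], so [y] must receive the digit one. *)
Lemma val_inv_step (M : structure) (HM : models k M) (x y d : M) a b q :
  Pw d -> lt x d -> lt y d -> a < k ->
  (forall c : bool, q = Some c <-> val_inv x y c) ->
  forall c : bool, val_step q (ext a (fun _ => b)) = Some c <->
    val_inv (sP x (mul a d)) (sP y (mul b d)) c.
Proof.
move=> Pd xd yd ak qI; have d0 := proj1 Pd.
have nd0 : d <> s0 M by case: d0 => _ /nesym.
have ad0 m : mul m d = s0 M -> m = 0.
  by case: m => // m /(mul_eq0 HM (ltn0Sn m)).
have apos : lt (s0 M) (mul a d) -> 0 < a by case: (posnP a) => // -> [_ []].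
have Vx : lt (s0 M) x -> sV (sP x (mul a d)) = sV x.
  move=> x0; case: (posnP a) => [->|a0]; first by rewrite (addx0 HM).
  apply: (Vadd HM) => //; first exact: (mul_pos HM).
  by rewrite (Vdig HM) ?a0 //; apply: (le_lt_trans HM) (Vle HM x) xd.
have Va : 0 < a -> sV (mul a d) = d by move=> a0; apply: (Vdig HM); rewrite ?a0.
have xpos : lt (s0 M) x -> lt (s0 M) (sP x (mul a d)).
  by move=> x0; apply: (lt_le_trans HM) x0 (le_addx HM _ _).
have eqy v : lt v d -> v = sP y (mul b d) -> b = 0 /\ v = y.
  move=> vd E; suff b0 : b = 0 by rewrite E b0 (addx0 HM).
  by apply/esym/(digit_eq HM vd yd); rewrite (addx0 HM).
have Vxd : lt (sV x) d by apply: (le_lt_trans HM) (Vle HM x) xd.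
have eqd : d = sP y (mul b d) -> b = 1 /\ y = s0 M.
  move=> E; have b1 : b = 1.
    by apply/esym/(digit_eq HM d0 yd); rewrite (add0x HM) (mul1 HM).
  split=> //; move: E; rewrite b1 (mul1 HM) => E.
  by apply/esym/(addI HM (z := d)); rewrite (add0x HM).
case: q qI => [[]|] qI.
- (* the first nonzero digit has been read *)
  have [x0 Vy] := (qI true).1 erefl.
  have yE : sV x = sP y (mul b d) <-> b = 0.
    by split=> [/(eqy _ Vxd)[]|->] //; rewrite (addx0 HM).
  case=> /=; rewrite ?Vx //; last first.
    split; first by case: eqP.
    by case=> /(add_eq0 HM) E; move: x0; rewrite E => /(lt_irr).
  rewrite yE; split=> [|[_ ->]] //; case: eqP => // b0 _; split=> //.
  exact: xpos.
- have [-> ->] := (qI false).1 erefl; rewrite !(add0x HM).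
  case=> /=.
    split.
      case: eqP => [|/eqP a0]; first by case: eqP.
      case: eqP => // -> _; rewrite (mul1 HM) Va ?lt0n //; split=> //.
      by apply: (mul_pos HM); rewrite ?lt0n.
    case=> /apos a0; rewrite Va // => E; rewrite -leqn0 leqNgt a0 /=.
    have [-> _ //] : b = 1 /\ y = s0 M.
    by apply: eqd; rewrite ((qI false).1 erefl).2 (add0x HM).
  split; last by case=> /ad0 -> /ad0 ->.
  case: (altP (a =P 0)) => [->|_]; first by case: (altP (b =P 0)) => // ->.
  by case: (altP (b =P 1)).
- have nT : ~ val_inv x y true by move/qI.
  have nF : ~ val_inv x y false by move/qI.
  case=> /=; split=> //.
    case=> xa E; case: (zero_or_pos HM x) => [x0|x0]; last first.
      by rewrite Vx // in E; case: (eqy _ Vxd E) => _ E'; case: nT.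
    move: xa E; rewrite x0 (add0x HM) => /apos a0.
    by rewrite Va // => /eqd[_ y0]; case: nF.
  by case=> /(add_eq0 HM) ? /(add_eq0 HM) ?; case: nF.
Qed.

Lemma st_val (M : structure) (HM : models k M) (r : nat -> M) :
  forall d, Pw d -> forall c : bool, st k val_dfa r d = Some c <->
    val_inv (lo (r 0) d) (lo (r 1) d) c.
Proof.
apply: (definable_ind hk HM).
- apply: definable_all => c; apply: definable_iff.
    exact: (definable_st hk HM).
  pose f := if c then (Zero < Var 0 /\ Vk (Var 0) = Var 1)%fo
            else (Var 0 = Zero /\ Var 1 = Zero)%fo.
  have D : Delta0 f by rewrite /f; case: (c); do ! constructor.
  have := definable_lo hk HM (r 0) (r 1) (r 1) r D.
  by apply: definable_ext => d _; rewrite /f /val_inv; case: (c).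
- move=> c; rewrite (st_1 hk HM) !(lo1 hk HM) /val_inv.
  by case: c; split=> // -[/lt_irr].
move=> d Pd IH c; rewrite (st_k hk HM) // !(lo_k hk HM) //.
rewrite -(val_inv_step HM _ Pd _ _ _ IH).
- by rewrite (@dstepP _ val_dfa _ _ (ext (dg k (r 0) d) (fun _ => dg k (r 1) d)))
    => // -[|[|]].
- exact: (lo_lt hk HM).
- exact: (lo_lt hk HM).
- exact: (dg_lt hk HM).
Qed.

Lemma recog_val : recog 2 (Vk (Var 0) = Var 1)%fo.
Proof.
exists val_dfa => M HM r d Pd rd; rewrite !inE.
have E c : st k val_dfa r d = Some c <-> val_inv (r 0) (r 1) c.
  by rewrite (st_val HM) // !(lo_small HM) //; apply: rd.
split=> [/= V01|/orP[]/eqP/E[]//=]; last by move=> -> ->; rewrite (V0 HM).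
apply/orP; case: (zero_or_pos HM (r 0)) => [r0|r0].
  by left; apply/eqP/E; rewrite /= -V01 r0 (V0 HM).
by right; apply/eqP/E.
Qed.

(** ** All formulas *)

Lemma recog_var_add n i j l : i < n -> j < n -> l < n ->
  recog n (Var i + Var j = Var l)%fo.
Proof.
move=> iltn jltn lltn.
have fn t : t < 3 -> nth 0 [:: i; j; l] t < n by case: t => [|[|[|]]].
exact: (recog_ren fn recog_add).
Qed.

Lemma recog_var_val n i j : i < n -> j < n -> recog n (Vk (Var i) = Var j)%fo.
Proof.
move=> iltn jltn.
have fn t : t < 2 -> nth 0 [:: i; j] t < n by case: t => [|[|]].
exact: (recog_ren fn recog_val).
Qed.

(** Zero is the only idempotent. *)
Lemma recog_var_zero n i : i < n -> recog n (Var i = Zero)%fo.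
Proof.
move=> iltn; apply: recog_equiv (recog_var_add iltn iltn iltn) => M HM r /=.
split=> [E|->]; last exact: (addx0 HM).
by apply: (addI HM (z := r i)); rewrite (add0x HM).
Qed.

Lemma recog_var_le n i j : i < n -> j < n -> recog n (Var i <= Var j)%fo.
Proof.
move=> iltn jltn.
have := recog_ex (@recog_var_add n.+1 0 i.+1 j.+1 isT iltn jltn).
apply: recog_equiv => M HM r /=; split=> [[z <-]|/(le_ex HM)] //.
by rewrite (addC HM); apply: (le_addx HM).
Qed.

Lemma recog_var_eq n i j : i < n -> j < n -> recog n (Var i = Var j)%fo.
Proof.
move=> iltn jltn.
have := recog_and (recog_var_le iltn jltn) (recog_var_le jltn iltn).
apply: recog_equiv => M HM r /=.
by split=> [[]|->]; [exact: (le_anti HM) | split; apply: (le_refl HM)].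
Qed.

(** One is the least nonzero number. *)
Lemma recog_var_one n i : i < n -> recog n (Var i = num 1)%fo.
Proof.
move=> iltn.
have := recog_and (recog_not (recog_var_zero iltn)) (recog_all (recog_or
  (@recog_var_zero n.+1 0 isT) (@recog_var_le n.+1 i.+1 0 iltn isT))).
apply: recog_equiv => M HM r /=; split.
  case=> /(lt0 HM) i0 H; apply: (le_anti HM); last exact: (pos_ge1 HM).
  by case: (H one) => [E|//]; case: (lt01 HM) => _ [].
move=> ->; split=> [E|a]; first by case: (lt01 HM) => _ [].
by case: (zero_or_pos HM a) => [|/(pos_ge1 HM)]; [left|right].
Qed.

Lemma eval_shn2 (M : structure) (r : nat -> M) a b m t :
  eval (ext b (ext a r)) (shn m.+2 t) = eval r (shn m t).
Proof. by rewrite !eval_shn. Qed.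

Lemma eval_shn1 (M : structure) (r : nat -> M) a m t :
  eval (ext a r) (shn m.+1 t) = eval r (shn m t).
Proof. by rewrite !eval_shn. Qed.

(** The values of the immediate subterms are named by quantified variables; the
    shift by [m] makes room for them. *)
Lemma recog_graph t n m j : tbound t <= n -> j < m + n ->
  recog (m + n) (shn m t = Var j)%fo.
Proof.
elim: t m j => [i||u IHu|u IHu v IHv|u IHu] m j /=.
- by move=> iltn jlt; apply: recog_var_eq; rewrite // ltn_add2l.
- move=> _ jlt; apply: recog_equiv (recog_var_zero jlt) => M HM r /=.
  by split=> ->.
- move=> un jlt.
  have := recog_ex (recog_ex (recog_and (IHu m.+2 1 un isT)
    (recog_and (@recog_var_one (m.+2 + n) 0 isT)
       (@recog_var_add (m.+2 + n) 1 0 j.+2 isT isT jlt)))).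
  apply: recog_equiv => M HM r; rewrite -/(shn m u) sat_eq; split.
    move=> /sat_ex[a /sat_ex[b /sat_and[/sat_eq]]]; rewrite eval_shn2 /= => ->.
    by case=> -> <-; rewrite (succE HM).
  move=> E; apply/sat_ex; exists (eval r (shn m u)).
  apply/sat_ex; exists one; apply/sat_and; split.
    by apply/sat_eq; rewrite eval_shn2.
  by split=> //=; rewrite -(succE HM).
- rewrite geq_max => /andP[un vn] jlt.
  have := recog_ex (recog_ex (recog_and (IHu m.+2 1 un isT)
    (recog_and (IHv m.+2 0 vn isT)
       (@recog_var_add (m.+2 + n) 1 0 j.+2 isT isT jlt)))).
  apply: recog_equiv => M HM r; rewrite -/(shn m u) -/(shn m v) sat_eq; split.
    move=> /sat_ex[a /sat_ex[b /sat_and[/sat_eq + /sat_and[/sat_eq]]]].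
    by rewrite !eval_shn2 /= => -> ->.
  move=> E; apply/sat_ex; exists (eval r (shn m u)).
  apply/sat_ex; exists (eval r (shn m v)); apply/sat_and; split.
    by apply/sat_eq; rewrite eval_shn2.
  by apply/sat_and; split=> //; apply/sat_eq; rewrite eval_shn2.
- move=> un jlt.
  have := recog_ex (recog_and (IHu m.+1 0 un isT)
       (@recog_var_val (m.+1 + n) 0 j.+1 isT jlt)).
  apply: recog_equiv => M HM r; rewrite -/(shn m u) sat_eq; split.
    by move=> /sat_ex[a /sat_and[/sat_eq]]; rewrite eval_shn1 /= => ->.
  move=> E; apply/sat_ex; exists (eval r (shn m u)).
  by apply/sat_and; split=> //; apply/sat_eq; rewrite eval_shn1.
Qed.

(** An atomic formula is a relation between variables once the values of its two
    terms have been named. *)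
Lemma recog_atom (op : term -> term -> formula)
    (R : forall M : structure, M -> M -> Prop) n t u :
  (forall (M : structure) (r : nat -> M) t u,
     sat r (op t u) <-> R M (eval r t) (eval r u)) ->
  recog n.+2 (op (Var 1) (Var 0)) -> tbound t <= n -> tbound u <= n ->
  recog n (op t u).
Proof.
move=> opR Rop tn un.
have := recog_ex (recog_ex (recog_and (@recog_graph t n 2 1 tn isT)
  (recog_and (@recog_graph u n 2 0 un isT) Rop))).
apply: recog_equiv => M HM r; rewrite opR; split.
  move=> /sat_ex[a /sat_ex[b /sat_and[/sat_eq + /sat_and[/sat_eq]]]].
  by rewrite !eval_sh2 opR /= => -> ->.
move=> H; apply/sat_ex; exists (eval r t); apply/sat_ex; exists (eval r u).
apply/sat_and; split; first by apply/sat_eq; rewrite eval_sh2.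
by apply/sat_and; split; [apply/sat_eq; rewrite eval_sh2 | rewrite opR].
Qed.

Lemma recog_formula p n : fbound p <= n -> recog n p.
Proof.
elim: p n => [|t u|t u|p IHp q IHq|p IHp q IHq|p IHp q IHq|p IHp|p IHp] n /=;
  rewrite ?geq_max.
- by move=> _; apply: recog_bot.
- case/andP; apply: (recog_atom (R := fun M => @eq M)) => //.
  exact: recog_var_eq.
- case/andP; apply: (recog_atom (R := @sle)) => //.
  exact: recog_var_le.
- by case/andP=> /IHp Rp /IHq; apply: recog_and.
- by case/andP=> /IHp Rp /IHq; apply: recog_or.
- by case/andP=> /IHp Rp /IHq; apply: recog_imp.
- by move=> pn; apply/recog_all/IHp; apply: leq_trans (leqSpred _) _.
- by move=> pn; apply/recog_ex/IHp; apply: leq_trans (leqSpred _) _.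
Qed.

(** * Provability *)

Lemma graph_g_bound (M : structure) (HM : models k M) n (r : nat -> M)
    (x : 'I_n -> term) (d : term) :
  sat r (graph_g k x d) -> Pw (eval r d) /\
    forall i, lt (eval r (x i)) (eval r d).
Proof.
case/sat_or => /sat_and[].
  move/sat_bigandP => x0 /sat_eq ->; split; first exact: (Pw1 HM).
  move=> i; have /sat_eq -> := x0 i (mem_index_enum _) isT.
  exact: (lt01 HM).
move=> Pd /sat_bigorP[i [_ _ /sat_and[/sat_bigandP xi /sat_and[/sat_lt xd _]]]].
split=> // j; apply: (le_lt_trans HM) xd; exact: (xi j (mem_index_enum _) isT).
Qed.

(** Axiom V4 gives the least power above the largest input. *)
Lemma graph_g_total (M : structure) (HM : models k M) n (r : nat -> M) :
  exists d : M, sat (ext d r) (graph_g k (fun i : 'I_n => Var i.+1) (Var 0)).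
Proof.
case: (pselect (forall i : 'I_n, r i = s0 M)) => [r0|nr0].
  exists one; apply/sat_or; left; apply/sat_and; split=> //.
  by apply/sat_bigandP => i _ _; apply: r0.
have [i0 ri0] : exists i : 'I_n, r i <> s0 M.
  apply: contrapT => H; apply: nr0 => i; apply: contrapT => ri.
  by apply: H; exists i.
have [i Hi] : exists i : 'I_n, forall j : 'I_n, sle (r j) (r i).
  suff : exists i : 'I_n, forall j : 'I_n, j \in enum 'I_n -> sle (r j) (r i).
    by case=> i Hi; exists i => j; apply: Hi; rewrite mem_enum.
  elim: (enum 'I_n) => [|j s [i Hi]]; first by exists i0.
  case: (le_total HM (r i) (r j)) => H; [exists j|exists i] => l;
    rewrite inE => /predU1P[->|/Hi] //; try exact: (le_refl HM).
  by move=> li; apply: (le_trans HM) li H.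
have ri : lt (s0 M) (r i).
  by apply: (lt_le_trans HM) (Hi i0); apply/(lt0 HM).
case: (V4_ex HM ri) => d [Pd dr rd]; exists (mul k d).
apply/sat_or; right; apply/sat_and; split; first exact: (Pwk hk HM).
apply/sat_bigorP; exists i; split=> //.
apply/sat_and; split; first by apply/sat_bigandP => j _ _; apply: Hi.
by apply/sat_and; split=> //; rewrite /= eval_tmul; apply: (mul_le HM).
Qed.

End Recognizable.

Lemma fbound_closure p n : fbound (iter n fAll p) = fbound p - n.
Proof. by elim: n => [|n IH] /=; rewrite ?subn0 // IH subnS. Qed.

Theorem theorem7 (k : nat) (hk : 2 <= k) (m : nat) (phi : formula)
    (hphi : fbound phi <= m) :
  exists A : automaton k m,
    deterministic A /\
    provable (Tk k)
      (iter m fAll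
         (fIff phi
            (\big[fOr/fBot]_(q in accept A) Wg q (fun i : 'I_m => Var i)))).
Proof.
have [A Ap] := recog_formula hk hphi.
exists (aut k A); split; first exact: aut_deterministic.
apply: completeness => [q [p _ ->]|M MT].
  by rewrite /closure fbound_closure subnn.
have HM : models k M.
  by move=> p Tp; apply/sat_closure/(MT (closure p)); exists p.
apply/sat_closure => r.
have satWg q d : Pw d -> sat (ext d r)
    (@W k m (aut k A) q (fun i => sh (Var i)) (Var 0)) <-> st k A r d = q.
  move=> Pd; rewrite -(stP hk HM) //; apply: (sat_W hk HM) => i.
  exact: eval_sh.
apply/sat_and; split; apply/sat_imp.
  move=> H; apply/sat_bigorP.
  case: (graph_g_total hk HM m r) => d gd.
  have [Pd rd] := graph_g_bound HM gd.
  exists (st k A r d); split; first exact: mem_index_enum.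
    by apply/(Ap M HM r d) => // i ilt; apply: (rd (Ordinal ilt)).
  by apply/sat_ex; exists d; apply/sat_and; split=> //; apply/satWg.
case/sat_bigorP => q [_ qA /sat_ex[d /sat_and[gd]]].
have [Pd rd] := graph_g_bound HM gd.
move/satWg => /(_ Pd) E; apply/(Ap M HM r d) => //; last by rewrite E.
by move=> i ilt; apply: (rd (Ordinal ilt)).
Qed.
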